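(* For any $u,\omega\in\mathcal{U}$ (assuming that the limit $\epsilon\to0$ and the expectation may be interchanged in $\lim_{\epsilon\to 0}\mathbb{E}\big[e^{\delta\Lambda_T(u)}\,\tfrac{1}{\epsilon}\big(e^{\delta\Lambda_T(u+\epsilon\omega)-\delta\Lambda_T(u)}-1\big)\big]$), $$\lim_{\epsilon\to0}\frac{J(u+\epsilon\omega)-J(u)}{\epsilon}=\delta\,\mathbb{E}\Bigg[\int_0^T\omega_t^{\intercal}\Big[B^{\intercal}e^{-A^{\intercal}t}M_{2,t}(u)+M_{1,t}(u)\Big(Ru_t+S^{\intercal}x_t-\zeta-B^{\intercal}\int_0^te^{A^{\intercal}(s-t)}(Qx_s+Su_s-\eta)\,ds\Big)\Big]dt\Bigg],$$ where $x$ is the state process under the control $u$ and $$M_{1,t}(u)=\mathbb{E}\big[e^{\delta\Lambda_T(u)}\,\big|\,\mathcal{F}_t\big],\qquad M_{2,t}(u)=\mathbb{E}\Big[e^{\delta\Lambda_T(u)}\Big(e^{A^{\intercal}T}\widehat{Q}x_T+\int_0^Te^{A^{\intercal}s}(Qx_s+Su_s-\eta)\,ds\Big)\,\Big|\,\mathcal{F}_t\Big].$$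
   Context: Fix $T>0$, $\mathcal{T}=[0,T]$, and a filtered probability space $(\Omega,\mathcal{F},\{\mathcal{F}_t\}_{t\in\mathcal{T}},\mathbb{P})$ carrying a standard $r$-dimensional Wiener process $w$. The state $x_t\in\mathbb{R}^n$, with given initial state $x_0$, is controlled by $u_t\in\mathbb{R}^m$ through $$dx_t=(Ax_t+Bu_t+b(t))\,dt+\sigma(t)\,dw_t,$$ where $A,B$ are constant matrices and $b,\sigma$ are deterministic continuous functions on $\mathcal{T}$, all of compatible dimensions. The cost functional is $J(u)=\mathbb{E}[\exp(\delta\Lambda_T(u))]$, where $0<\delta<\infty$ is a constant and $$\Lambda_T(u)=\frac12\int_0^T\Big(\langle Qx_s,x_s\rangle+2\langle Su_s,x_s\rangle+\langle Ru_s,u_s\rangle-2\langle\eta,x_s\rangle-2\langle\zeta,u_s\rangle\Big)ds+\frac12\langle\widehat{Q}x_T,x_T\rangle,$$ with constant matrices $Q,S,R,\widehat{Q}$ ($Q,R,\widehat Q$ symmetric) and vectors $\eta,\zeta$ of appropriate dimension. The information set is the filtration $\mathcal{F}_t=\sigma(x_s;0\le s\le t)$, and $\mathcal{U}$ is the Hilbert space of all $\mathbb{R}^m$-valued adapted processes with $\mathbb{E}[\int_0^T\|u_t\|^2dt]<\infty$.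
   Formalization: The formal theorem also assumes that ω_t^T times the bracket, with M_1, M_2 replaced by the unconditioned e^{δΛ_T(u)} and its product with the adjoint vector, is dt×P-integrable; without this the formula can fail (doubling-type ω). *)

(* Defs.v *)
(* Vectors are columns; processes are curried functions R -> Omega -> 'cV[R]_k,
   of which only the values at times in [0, T] matter. Measurability, continuity
   and integration of vector-valued maps are meant entrywise. *)
From HB Require Import structures.
From mathcomp Require Import all_boot all_order all_algebra.
From mathcomp Require Import all_classical all_reals all_analysis.

Set Implicit Arguments.
Unset Strict Implicit.
Unset Printing Implicit Defensive.

Import Order.TTheory GRing.Theory Num.Theory.
Import numFieldNormedType.Exports.

Local Open Scope classical_set_scope.
Local Open Scope ring_scope.

Section linear_algebra.
Context {R : realType}.

Definition dot (k : nat) (v w : 'cV[R]_k) : R := (v^T *m w) 0 0.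

Definition expm (k : nat) (A : 'M[R]_k) : 'M[R]_k :=
  \matrix_(i, j) limn (series (fun l : nat => (A ^+ l) i j / (l`!)%:R)).

Definition vint (k : nat) (D : set R) (f : R -> 'cV[R]_k) : 'cV[R]_k :=
  \col_i \int[@lebesgue_measure R]_(s in D) f s i 0.

End linear_algebra.

(* Data of dx = (A x + B u + b) dt + sigma dw on [0, hor] with cost
   E exp(risk * Lambda), see Lambda below. *)
Record lqg (R : realType) (n m r : nat) := Lqg {
  hor : R;
  risk : R;
  A_ : 'M[R]_n;
  B_ : 'M[R]_(n, m);
  b_ : R -> 'cV[R]_n;
  sig_ : R -> 'M[R]_(n, r);
  Q_ : 'M[R]_n;
  S_ : 'M[R]_(n, m);
  R_ : 'M[R]_m;
  Qhat_ : 'M[R]_n;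
  eta_ : 'cV[R]_n;
  zeta_ : 'cV[R]_m;
  hor_gt0 : 0 < hor;
  risk_gt0 : 0 < risk;
  b_cont : forall i, {within `[0, hor], continuous (fun t => b_ t i 0)};
  sig_cont : forall i j, {within `[0, hor], continuous (fun t => sig_ t i j)};
  Q_sym : Q_^T = Q_;
  R_sym : R_^T = R_;
  Qhat_sym : Qhat_^T = Qhat_ }.

Section probability.
Context {R : realType} {d : measure_display} {Omega : measurableType d}.
Variable P : probability Omega R.
Local Notation mu := (@lebesgue_measure R).

Definition vprocess (k : nat) := R -> Omega -> 'cV[R]_k.

Definition meas_wrt (G : set (set Omega)) (f : Omega -> R) : Prop :=
  forall C : set R, measurable C -> G (f @^-1` C).

Definition filtration (T : R) (F : R -> set (set Omega)) : Prop :=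
  [/\ forall t : R, 0 <= t <= T -> sigma_algebra [set: Omega] (F t),
      forall t : R, 0 <= t <= T -> F t `<=` measurable &
      forall s t : R, 0 <= s -> s <= t -> t <= T -> F s `<=` F t].

Definition adapted (T : R) (F : R -> set (set Omega)) (k : nat)
    (v : vprocess k) : Prop :=
  forall t : R, 0 <= t <= T -> forall i, meas_wrt (F t) (fun o => v t o i 0).

Definition jointly_measurable (T : R) (k : nat) (v : vprocess k) : Prop :=
  forall i, measurable_fun (`[0, T] `*` [set: Omega])
    (fun p : R * Omega => v p.1 p.2 i 0).

(* sigma(x_s; 0 <= s <= t), not augmented by the null sets. *)
Definition generated (k : nat) (x : vprocess k) (t : R) : set (set Omega) :=
  <<s [set E | exists s i (C : set R),
        [/\ 0 <= s <= t, measurable C & E = (fun o => x s o i 0) @^-1` C] ]>>.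

(* Standard r-dimensional Wiener process relative to F: the last clause says
   that w_t - w_s is independent of F_s and has law N(0, (t - s) I_r)
   (normal_prob takes the standard deviation). *)
Definition wiener (T : R) (F : R -> set (set Omega)) (r : nat)
    (w : vprocess r) : Prop :=
  [/\ adapted T F w,
      {ae P, forall o, w 0 o = 0},
      {ae P, forall o, forall j,
         {within `[0, T], continuous (fun t => w t o j 0)}} &
      forall s t : R, 0 <= s -> s < t -> t <= T ->
        forall (E : set Omega) (C : 'I_r -> set R),
          F s E -> (forall j, measurable (C j)) ->
          P (E `&` [set o | forall j, C j (w t o j 0 - w s o j 0)]) =
          (P E * \prod_(j < r) normal_prob 0 (Num.sqrt (t - s)) (C j))%E].

(* Left Riemann sum for int_0^t sigma dw on the uniform grid of k+1 steps. *)
Definition riemann_sum (n r : nat) (sigma : R -> 'M[R]_(n, r))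
    (w : vprocess r) (t : R) (k : nat) (o : Omega) : 'cV[R]_n :=
  \sum_(l < k.+1) sigma (l%:R / k.+1%:R * t) *m
    (w (l.+1%:R / k.+1%:R * t) o - w (l%:R / k.+1%:R * t) o).

(* N_t = int_0^t sigma(s) dw_s. The integrand being deterministic and
   continuous, the Ito integral is the mean-square limit of its left Riemann
   sums; N is the version with continuous paths. *)
Definition wiener_integral (T : R) (n r : nat) (sigma : R -> 'M[R]_(n, r))
    (w : vprocess r) (N : vprocess n) : Prop :=
  [/\ forall t : R, 0 <= t <= T -> forall i, measurable_fun setT (fun o => N t o i 0),
      forall o i, {within `[0, T], continuous (fun t => N t o i 0)} &
      forall t : R, 0 <= t <= T -> forall i,
        (fun k : nat =>
           'E_P[fun o => (((N t o - riemann_sum sigma w t k o) i 0) ^+ 2)%R]%E)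
          @ \oo --> 0%E].

(* Y is a version of E[Z | G]; Z is required to be integrable. *)
Definition cond_exp (G : set (set Omega)) (Z Y : Omega -> R) : Prop :=
  [/\ P.-integrable setT (EFin \o Z), P.-integrable setT (EFin \o Y),
      meas_wrt G Y &
      forall E, G E -> (\int[P]_(o in E) (Y o)%:E = \int[P]_(o in E) (Z o)%:E)%E].

Definition control (T : R) (F : R -> set (set Omega)) (m : nat)
    (v : vprocess m) : Prop :=
  [/\ jointly_measurable T v, adapted T F v &
      (\int[P]_o \int[mu]_(t in `[0%R, T]) (dot (v t o) (v t o))%:E < +oo)%E].

Definition perturb (m : nat) (u omega : vprocess m) (e : R) : vprocess m :=
  fun t o => u t o + e *: omega t o.

End probability.

Section control_problem.
Context {R : realType} {d : measure_display} {Omega : measurableType d}.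
Variable P : probability Omega R.
Context {n m r : nat}.
Variable p : lqg R n m r.
Local Notation mu := (@lebesgue_measure R).
Local Notation T := (hor p).
Local Notation delta := (risk p).
Local Notation A := (A_ p).
Local Notation B := (B_ p).
Local Notation b := (b_ p).
Local Notation Q := (Q_ p).
Local Notation S := (S_ p).
Local Notation Rm := (R_ p).
Local Notation Qhat := (Qhat_ p).
Local Notation eta := (eta_ p).
Local Notation zeta := (zeta_ p).

(* x solves dx = (A x + B v + b) dt + sigma dw with x_0 given, in integral form,
   where N = int sigma dw. As the noise is additive, the equation makes sense
   path by path; it is imposed for every outcome whose control path is
   integrable (almost every one, for a square-integrable control), so that the
   exceptional null set does not depend on the version of x and the states under
   the uncountably many controls u + e * omega can be compared pathwise. *)
Definition state (x0 : Omega -> 'cV[R]_n) (N : vprocess n) (v : vprocess m)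
    (x : vprocess n) : Prop :=
  jointly_measurable T x /\
  forall o,
    (forall j, mu.-integrable `[0, T] (fun t => (v t o j 0)%:E)) ->
    (forall i, {within `[0, T], continuous (fun t => x t o i 0)}) /\
    (forall t : R, 0 <= t <= T ->
       x t o = x0 o + vint `[0, t] (fun s => A *m x s o + B *m v s o + b s)
               + N t o).

Definition Lambda (x : vprocess n) (v : vprocess m) (o : Omega) : R :=
  2^-1 * (\int[mu]_(s in `[0, T])
            (dot (Q *m x s o) (x s o) + 2 * dot (S *m v s o) (x s o)
             + dot (Rm *m v s o) (v s o)
             - 2 * dot eta (x s o) - 2 * dot zeta (v s o)))
  + 2^-1 * dot (Qhat *m x T o) (x T o).

Definition weight (x : vprocess n) (v : vprocess m) (o : Omega) : R :=
  expR (delta * Lambda x v o).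

(* J(v) as an extended real; X maps a control to its state process. *)
Definition cost (X : vprocess m -> vprocess n) (v : vprocess m) : \bar R :=
  'E_P[weight (X v) v]%E.

Definition adjoint (x : vprocess n) (v : vprocess m) (o : Omega) : 'cV[R]_n :=
  expm (T *: A^T) *m (Qhat *m x T o)
  + vint `[0, T] (fun s => expm (s *: A^T) *m (Q *m x s o + S *m v s o - eta)).

(* The bracket multiplying omega_t in the Gateaux derivative, with m1 and m2
   standing for exp(delta Lambda), exp(delta Lambda) * adjoint or for their
   conditional expectations given the information at time t. *)
Definition gradient (x : vprocess n) (v : vprocess m) (m1 : R) (m2 : 'cV[R]_n)
    (t : R) (o : Omega) : 'cV[R]_m :=
  B^T *m (expm (- t *: A^T) *m m2)
  + m1 *: (Rm *m v t o + S^T *m x t o - zeta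
           - B^T *m vint `[0, t] (fun s =>
               expm ((s - t) *: A^T) *m (Q *m x s o + S *m v s o - eta))).

Definition diff_quot (X : vprocess m -> vprocess n) (u omega : vprocess m)
    (e : R) (o : Omega) : R :=
  let v := perturb u omega e in
  weight (X u) u o *
  (e^-1 * (expR (delta * Lambda (X v) v o - delta * Lambda (X u) u o) - 1)).

End control_problem.

(* Main.v *)
(* Pathwise, the difference quotient y of the states under u + e omega and u
   solves y' = A y + B omega and does not depend on e, so that
   Lambda(u + e omega) = Lambda(u) + e L + e^2 q exactly, and the difference
   quotients of the exponential converge to delta exp(delta Lambda(u)) L.
   Variation of constants and an integration by parts of <q_t, e^{-At} y_t>, where
   q_t is the adjoint minus int_0^t e^{A^T s}(Q x_s + S u_s - eta) ds, rewrite L as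
   the time integral of <omega_t, gradient_t>.

   It remains to condition on F_t under the time integral. At a fixed t, the
   coefficients of exp(delta Lambda) and exp(delta Lambda) * adjoint in
   <omega_t, gradient_t> contain int_0^t e^{A^T(s-t)}(Q x_s + S u_s - eta) ds,
   which is measurable only for the completion of F_t. A bounded f is measurable
   for this completion as soon as E[xi f] = 0 for every integrable xi that
   integrates to 0 over the sets of F_t, and this property passes to time
   integrals by Fubini. Truncating the coefficients then gives both the equality
   of the expectations and the L^1 bound that puts M_1 and M_2 within reach of
   Fubini's theorem. *)
Require Import Defs.
From HB Require Import structures.
From mathcomp Require Import all_boot all_order all_algebra.
From mathcomp Require Import all_classical all_reals all_analysis.
From mathcomp Require Import measurable_realfun ring lra.

Set Implicit Arguments.
Unset Strict Implicit.
Unset Printing Implicit Defensive.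

Import Order.TTheory GRing.Theory Num.Theory.
Import numFieldNormedType.Exports.

Local Open Scope classical_set_scope.
Local Open Scope ring_scope.

(** * Integrals *)

(** Adapted and jointly measurable does not mean progressively measurable, so Fubini's theorem on
    [0, t] x Omega cannot be applied with F_t in place of the full sigma-algebra; the duality test
    takes its place. The bounded functions that pass the test are the bipolar of the indicators of
    F_t in the pairing of L^1 with L^oo. They are measurable for the completion because they form an
    algebra closed under bounded pointwise limits, in which indicators of level sets can be built
    from limits of exponentials. The interchange hypothesis makes only the whole inner product with
    the unconditioned gradient integrable. Its separate terms need not be, and nothing is assumed
    about the product of omega with M_1 and M_2: hence conditioning acts on a sum, and the L^1 bound
    has to be proved before any expectation with M_1 and M_2 makes sense. The cost of u + e omega
    may be infinite, so the difference quotients of the cost live in the extended reals. *)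

Section integral_null_sets.
Context {d} {T : measurableType d} {R : realType}.
Variable mu : {measure set T -> \bar R}.
Local Open Scope ereal_scope.
Import HBNNSimple.

(** The integral of a nonnegative function is a supremum over the simple functions below it,
    measurable or not. Cut off on the null set [N], a simple function below [f] lies below [g] and
    keeps its integral. *)
Let ge0_le_integral_ae (f g : T -> \bar R) :
  (forall x, 0 <= f x) -> (forall x, 0 <= g x) ->
  {ae mu, forall x, f x = g x} -> \int[mu]_x f x <= \int[mu]_x g x.
Proof.
move=> f0 g0 [N [mN N0 fgN]].
rewrite ge0_integralTE// (ge0_integralTE _ g0).
apply: ge_ereal_sup => _ [h /= hf <-].
apply: ereal_sup_ubound; exists (proj_nnsfun h (measurableC mN)) => [x|] /=.
  rewrite mindicE; have [|_] := boolP (x \in ~` N); last by rewrite mulr0.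
  rewrite mulr1 inE => xN.
  suff <- : f x = g x by exact: hf.
  by apply: contrapT => fgx; exact/xN/fgN.
rewrite -!integralT_nnsfun; apply: ae_eq_integral => //.
- exact/measurable_EFinP.
- exact/measurable_EFinP.
exists N; split => // x /= /not_implyP[_].
apply: contra_notP => xN; rewrite mindicE mem_set// mulr1.
by [].
Qed.

(* Measurability is not assumed: on the null set of outcomes whose control path
   is not integrable, the limit of the difference quotients is arbitrary. *)
Lemma ae_eq_integral_nonmeasurable (f g : T -> \bar R) :
  {ae mu, forall x, f x = g x} -> \int[mu]_x f x = \int[mu]_x g x.
Proof.
have ge0 : forall f g : T -> \bar R, (forall x, 0 <= f x) ->
    (forall x, 0 <= g x) -> {ae mu, forall x, f x = g x} ->
    \int[mu]_x f x = \int[mu]_x g x.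
  move=> {}f {}g f0 g0 fg; apply/eqP; rewrite eq_le !ge0_le_integral_ae//.
  by apply: filterS fg => x ->.
move=> fg; rewrite [LHS]integralE [RHS]integralE; congr (_ - _).
- by apply: ge0 => //; apply: filterS fg => x; rewrite !funeposE => ->.
- by apply: ge0 => //; apply: filterS fg => x; rewrite !funenegE => ->.
Qed.

End integral_null_sets.

Section integral_difference.
Context {d} {T : measurableType d} {R : realType}.
Variable mu : {measure set T -> \bar R}.
Variables f g : T -> R.
Hypothesis mf : measurable_fun setT f.
Hypothesis f0 : forall x, 0 <= f x.
Hypothesis ig : mu.-integrable setT (EFin \o g).
Local Open Scope ereal_scope.

Let ifE : \int[mu]_x (f x)%:E < +oo -> mu.-integrable setT (EFin \o f).
Proof.
move=> fy; apply/integrableP; split; first exact/measurable_EFinP.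
by under eq_integral do rewrite /= ger0_norm//.
Qed.

Let negl : \int[mu]_x (EFin \o (f \- g)%R)^\- x < +oo.
Proof.
have /integrableP[mg gy] := ig.
apply: le_lt_trans gy; apply: ge0_le_integral => //.
- by apply: measurable_funeneg; apply/measurable_EFinP; apply: measurable_funB => //;
  exact/measurable_EFinP.
- exact: measurableT_comp.
- move=> x _; rewrite funenegE /= -EFin_max lee_fin ge_max normr_ge0 andbT.
  by rewrite opprB (le_trans _ (ler_norm _))// gerBl.
Qed.

(** [f] plays the cost integrand of a perturbed control, whose integral may be infinite. Then both
    sides are [+oo]: the negative part of [f - g] is at most [|g|], and were the positive part
    integrable, so would be [f = (f - g) + g]. *)
Lemma ge0_integralB_EFin :
  \int[mu]_x (f x - g x)%:E = \int[mu]_x (f x)%:E - \int[mu]_x (g x)%:E.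
Proof.
have [fy|] := boolP (\int[mu]_x (f x)%:E < +oo).
  by rewrite -integralB_EFin//; exact: ifE.
rewrite -leNgt leye_eq => /eqP fy; rewrite fy.
have gfin := integrable_fin_num measurableT ig.
rewrite addye; last by rewrite eqe_oppLR; move: gfin; rewrite fin_numE => /andP[].
have mfg : measurable_fun setT (f \- g)%R.
  by apply: measurable_funB => //; apply/measurable_EFinP; exact: measurable_int ig.
rewrite integralE -/(EFin \o (f \- g)%R).
have [py|] := boolP (\int[mu]_x (EFin \o (f \- g)%R)^\+ x < +oo); last first.
  rewrite -leNgt leye_eq => /eqP ->; rewrite addye// eqe_oppLR /=.
  by move: negl; rewrite ltey.
exfalso; move/eqP: fy; apply/negP; rewrite -ltey.
have ifg : mu.-integrable setT (EFin \o (f \- g)%R).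
  apply/integrableP; split; first exact/measurable_EFinP.
  rewrite [X in \int[mu]_(x in _) X x](_ : _ = fun x => (EFin \o (f \- g)%R)^\+ x +
    (EFin \o (f \- g)%R)^\- x); last first.
    by rewrite -fune_abse.
  rewrite ge0_integralD//; first by rewrite lte_add_pinfty//; exact: negl.
  - by apply: measurable_funepos; exact/measurable_EFinP.
  - by apply: measurable_funeneg; exact/measurable_EFinP.
have := integrableD measurableT ifg ig => /(integrable_lty measurableT).
by under eq_integral do rewrite /= -EFinD subrK.
Qed.

End integral_difference.

(** Meant for [c = e^-1], which takes both signs as [e] tends to 0. For [c < 0] the sign is moved
    through the integral; this is legitimate because the negative part of [- c * (f - g)] is at most
    [- c * g], hence integrable. *)
Lemma ge0_integralBZ_EFin {d} {T : measurableType d} {R : realType}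
    (mu : {measure set T -> \bar R}) (f g : T -> R) (c : R) :
  measurable_fun setT f -> measurable_fun setT g ->
  (forall x, 0 <= f x) -> (forall x, 0 <= g x) ->
  mu.-integrable setT (EFin \o g) ->
  (\int[mu]_x (c * (f x - g x))%:E =
   (\int[mu]_x (f x)%:E - \int[mu]_x (g x)%:E) * c%:E)%E.
Proof.
move=> mf mg f0 g0 ig.
have pos (k : R) : 0 <= k -> (\int[mu]_x (k * (f x - g x))%:E =
    (\int[mu]_x (f x)%:E - \int[mu]_x (g x)%:E) * k%:E)%E.
  move=> k0; under eq_integral do rewrite mulrBr.
  rewrite ge0_integralB_EFin; last 3 first.
  - exact: measurable_funM.
  - by move=> x; rewrite mulr_ge0.
  - exact: (integrableZl measurableT k ig).
  under eq_integral do rewrite EFinM.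
  under [X in (_ - X)%E]eq_integral do rewrite EFinM.
  have mF (h : T -> R) : measurable_fun setT h -> measurable_fun setT (fun x => (h x)%:E).
    by move=> mh; exact/measurable_EFinP.
  rewrite !ge0_integralZl ?lee_fin//; [|by apply: mF|by move=> x _;
    rewrite lee_fin|by apply: mF|by move=> x _; rewrite lee_fin].
  rewrite [RHS]muleC [RHS]muleBr//.
  by rewrite fin_num_adde_defl// fin_numN (integrable_fin_num measurableT ig).
have [c0|c0] := leP 0 c; first exact: pos.
have gfin := integrable_fin_num measurableT ig.
transitivity (- \int[mu]_x (- c * (f x - g x))%:E)%E; last first.
  by rewrite pos ?oppr_ge0 ?ltW// EFinN muleN oppeK.
under [in RHS]eq_integral do rewrite mulNr.
under eq_integral do rewrite -[X in X%:E]opprK EFinN.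
rewrite integralN//.
apply: fin_num_adde_defl.
rewrite fin_numN.
set h := fun x : T => _.
have mh : measurable_fun setT (EFin \o (fun x => - (c * (f x - g x)))).
  apply/measurable_EFinP; apply: measurable_funN; apply: measurable_funM => //.
  exact: measurable_funB.
rewrite ge0_fin_numE; last exact: integral_ge0.
apply: (@le_lt_trans _ _ (\int[mu]_x ((- c)%:E * `|(g x)%:E|)))%E; last first.
  have mg' : measurable_fun setT (fun x => `|(g x)%:E|%E).
    by apply: measurableT_comp => //; exact/measurable_EFinP.
  have c0' : (0 <= (- c)%:E)%E by rewrite lee_fin oppr_ge0 ltW.
  have /integrableP[_ gy] := ig.
  by rewrite (ge0_integralZl _ measurableT mg' _ c0')// lte_mul_pinfty.
apply: ge0_le_integral => //.
- exact: measurable_funeneg.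
- apply: measurable_funeM; apply: measurableT_comp => //; exact/measurable_EFinP.
- move=> x _; rewrite funenegE -EFinN -EFin_max lee_fin ge_max opprK.
  have cf : c * f x <= 0 by rewrite mulr_le0_ge0// ltW.
  have cg : c * g x <= 0 by rewrite mulr_le0_ge0// ltW.
  by rewrite ger0_norm// mulNr mulrBr oppr_ge0 cg andbT gerDr.
Qed.

Section parameterized_integrals.
Context {d1 d2} {T1 : measurableType d1} {T2 : measurableType d2} {R : realType}.
Variable m2 : {sigma_finite_measure set T2 -> \bar R}.

(** Divergent integrals are sent to 0 by [fine], a measurable map, so Tonelli's theorem for the
    positive and the negative part suffices. *)
Lemma measurable_Rintegral_param (f : T1 * T2 -> R) :
  measurable_fun setT f ->
  measurable_fun setT (fun z => \int[m2]_s f (z, s)).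
Proof.
move=> mf; apply: measurableT_comp => //.
have mF : measurable_fun setT (EFin \o f) by exact/measurable_EFinP.
rewrite (_ : (fun z => _) = (fun z => \int[m2]_s (EFin \o f)^\+ (z, s)
    - \int[m2]_s (EFin \o f)^\- (z, s))%E); last first.
  apply/funext => z; rewrite [LHS]integralE.
  by congr (_ - _)%E; apply: eq_integral => s _; rewrite ?funeposE ?funenegE.
apply: emeasurable_funB.
- by apply: measurable_fun_fubini_tonelli_F => //; exact: measurable_funepos.
- by apply: measurable_fun_fubini_tonelli_F => //; exact: measurable_funeneg.
Qed.

(** Covers domains that move with the parameter, such as [[0, t]] with [t] a variable: [B z] is the
    section of [E] at [z], and [f] is extended by 0 outside [E]. *)
Lemma measurable_Rintegral_xsection (D : set T1) (E : set (T1 * T2))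
    (f : T1 * T2 -> R) (B : T1 -> set T2) :
  measurable D -> measurable E -> measurable_fun E f ->
  (forall z s, D z -> B z s <-> E (z, s)) ->
  measurable_fun D (fun z => \int[m2]_(s in B z) f (z, s)).
Proof.
move=> mD mE mf BE.
have mfE : measurable_fun setT (f \_ E) by apply/(measurable_restrictT _ _).1.
apply: eq_measurable_fun (measurable_funTS (measurable_Rintegral_param mfE)).
move=> z /set_mem Dz; rewrite [RHS]Rintegral_mkcond; apply: eq_Rintegral => s _.
rewrite !patchE; congr (if _ then _ else _).
by apply/idP/idP; rewrite !inE => /(BE _ _ Dz).
Qed.

End parameterized_integrals.

(** * Absolutely continuous functions *)

Section integral_product.
Context {R : realType}.
Local Notation mu := (@lebesgue_measure R).

Lemma integrable_continuousM (a b : R) (h k : R -> R) :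
  {within `[a, b], continuous h} -> mu.-integrable `[a, b] (EFin \o k) ->
  mu.-integrable `[a, b] (EFin \o (fun s => h s * k s)).
Proof.
move=> ch ik.
have mh : measurable_fun `[a, b] h by exact: subspace_continuous_measurable_fun.
have bh : [bounded h x | x in `[a, b]%classic].
  have /compact_bounded[M [_ mrt]] := continuous_compact ch (@segment_compact R a b).
  by exists M; split; rewrite ?num_real // => ? ? ? ?; exact: mrt.
exact: (@integrableMr _ _ _ mu _ (measurable_itv _) h (EFin \o k) mh bh ik).
Qed.

Let integrable_prod (f g : R -> R) (A : set (R * R)) : measurable A ->
  mu.-integrable setT (EFin \o f) -> mu.-integrable setT (EFin \o g) ->
  (mu \x mu)%E.-integrable setT
    (EFin \o (fun z => f z.1 * g z.2 * \1_A z)).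
Proof.
move=> mA /integrableP[mf fy] /integrableP[mg gy].
have mh : measurable_fun setT (fun z : R * R => f z.1 * g z.2).
  by apply: measurable_funM; apply: measurableT_comp => //; exact/measurable_EFinP.
apply/integrable12ltyP.
  by apply/measurable_EFinP; apply: measurable_funM => //; exact: measurable_indic.
have mgn : measurable_fun setT (fun y => `|(g y)%:E|%E).
  by apply: measurableT_comp.
have mfn : measurable_fun setT (fun y => `|(f y)%:E|%E).
  by apply: measurableT_comp.
apply: (@le_lt_trans _ _ (\int[mu]_x (`|(f x)%:E| * \int[mu]_y `|(g y)%:E|))%E);
  last first.
  rewrite ge0_integralZr//; last exact: integral_ge0.
  apply: lte_mul_pinfty => //; first exact: integral_ge0.
  by rewrite ge0_fin_numE//; exact: integral_ge0.
have mH : measurable_fun setT (fun z : R * R => `|(f z.1 * g z.2 * \1_A z)%:E|%E).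
  apply: measurableT_comp => //; apply/measurable_EFinP; apply: measurable_funM => //.
apply: ge0_le_integral => //.
- by move=> x _; exact: integral_ge0.
- have h0 (z : R * R) : (0 <= `|(f z.1 * g z.2 * \1_A z)%:E|)%E by [].
  exact: (measurable_fun_fubini_tonelli_F (m2 := mu) _ mH h0).
- by apply: emeasurable_funM => //; exact: measurable_cst.
move=> x _; rewrite -ge0_integralZl//.
apply: ge0_le_integral => //.
- apply: (measurableT_comp mH); exact: pair1_measurable.
- exact: measurable_funeM.
move=> y _; rewrite -abseM -EFinM !abse_EFin lee_fin /= [leLHS]normrM.
by apply: ler_piMr => //; rewrite indicE; case: (_ \in _); rewrite /= ?normr1 ?normr0.
Qed.

(** The square [[0, t]^2] is cut along its diagonal. On the half [s < r], Fubini's theorem exchanges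
    an inner integral over []s, t]] with one over [[0, r[]. *)
Lemma Rintegral_product_triangle (f g : R -> R) (t : R) : 0 <= t ->
  mu.-integrable `[0, t] (EFin \o f) -> mu.-integrable `[0, t] (EFin \o g) ->
  \int[mu]_(s in `[0, t]) f s * \int[mu]_(s in `[0, t]) g s =
  \int[mu]_(s in `[0, t]) (f s * \int[mu]_(r in `[0, s]) g r) +
  \int[mu]_(s in `[0, t]) (g s * \int[mu]_(r in `[0, s]) f r).
Proof.
move=> t0 intf intg.
have mI (s : R) : measurable (`[0, s]%classic : set R) by exact: measurable_itv.
have intS (h : R -> R) (s : R) : mu.-integrable `[0, t] (EFin \o h) -> s \in `[0, t] ->
    mu.-integrable `[0, s] (EFin \o h).
  move=> inth; rewrite in_itv => /= /andP[s0 st]; apply: integrableS inth => //.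
  by apply: subset_itvl; rewrite bnd_simp.
have intM (h k : R -> R) : mu.-integrable `[0, t] (EFin \o h) ->
    mu.-integrable `[0, t] (EFin \o k) ->
    mu.-integrable `[0, t] (EFin \o (fun s => h s * \int[mu]_(r in `[0, s]) k r)).
  move=> inth intk.
  have cK := parameterized_integral_continuous t0 intk.
  have := integrable_continuousM cK inth.
  by apply: eq_integrable => // s _ /=; rewrite mulrC.
have split s : s \in `[0, t] -> \int[mu]_(r in `[0, t]) g r =
    \int[mu]_(r in `[0, s]) g r + \int[mu]_(r in `]s, t]) g r.
  move=> st; apply/eqP; rewrite addrC -subr_eq; apply/eqP.
  apply: Rintegral_itvB => //; move: st; rewrite in_itv/= bnd_simp => /andP[s0 st] //.
rewrite -RintegralZr//.
transitivity (\int[mu]_(s in `[0, t]) (f s * \int[mu]_(r in `[0, s]) g r +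
    f s * \int[mu]_(r in `]s, t]) g r)).
  by apply: eq_Rintegral => s /set_mem st; rewrite (split _ st) mulrDr.
pose A := [set z : R * R | z.1 < z.2].
have mA : measurable A.
  have : measurable_fun [set: R * R] (fun z : R * R => z.1 < z.2).
    by apply: measurable_fun_ltr.
  by move=> /(_ measurableT [set true]); rewrite setTI; apply.
pose f0 := f \_ `[0, t]; pose g0 := g \_ `[0, t].
have if0 : mu.-integrable setT (EFin \o f0) by rewrite -restrict_EFin;
  apply/integrable_restrict => //=; rewrite setTI.
have ig0 : mu.-integrable setT (EFin \o g0) by rewrite -restrict_EFin;
  apply/integrable_restrict => //=; rewrite setTI.
have H2 := integrable_prod mA if0 ig0.
have inner1 s : s \in `[0, t] -> \int[mu]_r (f0 s * g0 r * \1_A (s, r)) =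
    f s * \int[mu]_(r in `]s, t]) g r.
  move=> st; have st' : s \in `[0, t]%classic by rewrite inE.
  have fs : f0 s = f s by rewrite /f0 patchE st'.
  rewrite -RintegralZl//; last first.
    apply: integrableS intg => //; move: st; rewrite in_itv => /= /andP[s0 st].
    by apply: subset_itvr; rewrite bnd_simp.
  rewrite [RHS]Rintegral_mkcond; apply: eq_Rintegral => r _.
  rewrite fs patchE /g0 patchE indicE.
  move: st; rewrite in_itv => /= /andP[s0 st].
  have -> : (r \in `]s, t]%classic) = (s < r) && (r <= t).
    by apply/idP/idP; rewrite inE /= in_itv.
  have -> : (r \in `[0, t]%classic) = (0 <= r <= t).
    by apply/idP/idP; rewrite inE /= in_itv.
  have -> : ((s, r) \in A) = (s < r) by apply/idP/idP; rewrite inE.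
  have [sr|_] := ltP s r; rewrite ?mulr0//= mulr1 (le_trans s0 (ltW sr))/=.
  by case: ifP; rewrite ?mulr0.
have inner2 r : r \in `[0, t] -> \int[mu]_s (f0 s * g0 r * \1_A (s, r)) =
    g r * \int[mu]_(s in `[0, r]) f s.
  move=> rt; have rt' : r \in `[0, t]%classic by rewrite inE.
  have gr : g0 r = g r by rewrite /g0 patchE rt'.
  rewrite -RintegralZl//; last exact: intS.
  rewrite -Rintegral_itv_bndo_bndc; last first.
    have ih := intS _ _ intf rt; have ih' := @integrableZl _ _ _ mu _ (mI r) (g r) _ ih.
    by apply: integrableS ih' => //; apply: subset_itvl; rewrite bnd_simp.
  rewrite [RHS]Rintegral_mkcond; apply: eq_Rintegral => s _.
  rewrite gr patchE /f0 patchE indicE.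
  move: rt; rewrite in_itv => /= /andP[r0 rt].
  have -> : (s \in `[0, r[%classic) = (0 <= s < r).
    by apply/idP/idP; rewrite inE /= in_itv.
  have -> : (s \in `[0, t]%classic) = (0 <= s <= t).
    by apply/idP/idP; rewrite inE /= in_itv.
  have -> : ((s, r) \in A) = (s < r) by apply/idP/idP; rewrite inE.
  have [sr|_] := ltP s r; rewrite ?andbF ?mulr0//= mulr1 (le_trans (ltW sr) rt) !andbT.
  by case: ifP; rewrite ?mul0r// mulrC.
have out1 s : s \notin `[0, t] -> \int[mu]_r (f0 s * g0 r * \1_A (s, r)) = 0.
  move=> st; have st' : s \notin `[0, t]%classic by apply: contra st; rewrite inE.
  have fs : f0 s = 0 by rewrite /f0 patchE (negbTE st').
  under eq_Rintegral do rewrite fs !mul0r.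
  by rewrite Rintegral_cst// mul0r.
have out2 r : r \notin `[0, t] -> \int[mu]_s (f0 s * g0 r * \1_A (s, r)) = 0.
  move=> rt; have rt' : r \notin `[0, t]%classic by apply: contra rt; rewrite inE.
  have gr : g0 r = 0 by rewrite /g0 patchE (negbTE rt').
  under eq_Rintegral do rewrite gr mulr0 mul0r.
  by rewrite Rintegral_cst// mul0r.
have fin1 s : (\int[mu]_r (f0 s * g0 r * \1_A (s,
  r))%:E = (\int[mu]_r (f0 s * g0 r * \1_A (s, r)))%R%:E)%E.
  rewrite fineK//; apply: integrable_fin_num => //.
  have m1 : measurable_fun setT (fun r => f0 s * \1_A (s, r)).
    apply: measurable_funM => //; apply: measurableT_comp; last exact: pair1_measurable.
    exact: measurable_indic.
  have b1 : [bounded (f0 s * \1_A (s, r)) | r in setT].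
    exists `|f0 s|; split; first exact: num_real.
    move=> M fM r _ /=; rewrite normrM indicE; apply: (le_trans _ (ltW fM)).
    by apply: ler_piMr => //; case: (_ \in _); rewrite /= ?normr1 ?normr0.
  have := @integrableMr _ _ _ mu _ measurableT _ _ m1 b1 ig0.
  by apply: eq_integrable => // r _ /=; rewrite -EFinM mulrAC.
have fin2 r : (\int[mu]_s (f0 s * g0 r * \1_A (s,
  r))%:E = (\int[mu]_s (f0 s * g0 r * \1_A (s, r)))%R%:E)%E.
  rewrite fineK//; apply: integrable_fin_num => //.
  have m1 : measurable_fun setT (fun s => g0 r * \1_A (s, r)).
    apply: measurable_funM => //; apply: measurableT_comp; last exact: pair2_measurable.
    exact: measurable_indic.
  have b1 : [bounded (g0 r * \1_A (s, r)) | s in setT].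
    exists `|g0 r|; split; first exact: num_real.
    move=> M fM s _ /=; rewrite normrM indicE; apply: (le_trans _ (ltW fM)).
    by apply: ler_piMr => //; case: (_ \in _); rewrite /= ?normr1 ?normr0.
  have := @integrableMr _ _ _ mu _ measurableT _ _ m1 b1 if0.
  by apply: eq_integrable => // s _ /=; rewrite -EFinM mulrC mulrA.
have /(congr1 fine) H3 := Fubini H2.
have E1 : fine (\int[mu]_x \int[mu]_y (EFin \o (fun z : R * R => (f0 z.1 * g0 z.2 *
  \1_A z)%R)) (x, y)) =
    \int[mu]_(s in `[0, t]) (f s * \int[mu]_(r in `]s, t]) g r).
  rewrite [RHS]Rintegral_mkcond; congr fine; apply: eq_integral => s _ /=.
  rewrite fin1; congr EFin; rewrite patchE.
  case: ifPn => [/set_mem/inner1//|st].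
  by apply: out1; apply: contra st; rewrite inE.
have E2 : fine (\int[mu]_y \int[mu]_x (EFin \o (fun z : R * R => (f0 z.1 * g0 z.2 *
  \1_A z)%R)) (x, y)) =
    \int[mu]_(s in `[0, t]) (g s * \int[mu]_(r in `[0, s]) f r).
  rewrite [RHS]Rintegral_mkcond; congr fine; apply: eq_integral => s _ /=.
  rewrite fin2; congr EFin; rewrite patchE.
  case: ifPn => [/set_mem/inner2//|st].
  by apply: out2; apply: contra st; rewrite inE.
have iFG := @integrableZl _ _ _ mu _ (mI t) (\int[mu]_(r in `[0, t]) g r) _ intf.
have iH : mu.-integrable `[0, t]
    (EFin \o (fun s => f s * \int[mu]_(r in `]s, t]) g r)).
  have := @integrableB _ _ _ mu _ (mI t) _ _ iFG (intM _ _ intf intg).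
  apply: eq_integrable; first exact: mI.
  move=> s /set_mem st; rewrite /= (split _ st) -EFinM -EFinB; congr EFin.
  by rewrite mulrC mulrDr addrC addKr.
rewrite (@RintegralD _ _ _ mu _ _ _ (mI t) (intM _ _ intf intg) iH).
by rewrite -E1 H3 E2.
Qed.

End integral_product.

Section absolute_continuity.
Context {R : realType}.
Local Notation mu := (@lebesgue_measure R).

(* Absolute continuity in integral form: the product rule [has_densityM] then
   rests on Fubini over a triangle and needs no almost everywhere derivative. *)
Definition has_density (T : R) (F f : R -> R) : Prop :=
  mu.-integrable `[0, T] (EFin \o f) /\
  {in `[0, T], forall t, F t = F 0 + \int[mu]_(s in `[0, t]) f s}.

Variables (T : R).
Hypothesis T0 : 0 <= T.

Lemma integrable_sub_itv (f : R -> R) (t : R) :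
  mu.-integrable `[0, T] (EFin \o f) -> t \in `[0, T] ->
  mu.-integrable `[0, t] (EFin \o f).
Proof.
move=> intf; rewrite in_itv => /= /andP[t0 tT]; apply: integrableS intf => //.
by apply: subset_itvl; rewrite bnd_simp.
Qed.

Lemma in_sub_itv (s t : R) : t \in `[0, T] -> s \in `[0, t] -> s \in `[0, T].
Proof.
rewrite !in_itv /= => /andP[_ tT] /andP[-> st] /=; exact: le_trans tT.
Qed.

Lemma has_density_continuous F f : has_density T F f ->
  {within `[0, T], continuous F}.
Proof.
move=> [intf FE].
have c : {within `[0, T], continuous (fun t => F 0 + \int[mu]_(s in `[0, t]) f s)}.
  move=> x; apply: cvgD; first exact: cvg_cst.
  exact: (parameterized_integral_continuous T0 intf).
apply: subspace_eq_continuous c => t /set_mem tT.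
by rewrite /from_subspace/= [RHS]FE.
Qed.

Lemma eq_has_density F f G g : {in `[0, T], F =1 G} -> {in `[0, T], f =1 g} ->
  has_density T F f -> has_density T G g.
Proof.
move=> FG fg [intf FE]; split.
  by apply: eq_integrable intf => // t /set_mem /fg /= ->.
move=> t tT; rewrite -(FG _ tT) -FG ?in_itv/= ?lexx// FE//; congr (_ + _).
by apply: eq_Rintegral => s /set_mem /(in_sub_itv tT)/fg.
Qed.

Lemma has_density_cst c : has_density T (cst c) (cst 0).
Proof.
split=> [|t _]; last by rewrite Rintegral_cst// mul0r addr0.
exact: (@integrable0 _ _ _ mu).
Qed.

Lemma has_densityD F f G g : has_density T F f -> has_density T G g ->
  has_density T (fun t => F t + G t) (fun t => f t + g t).
Proof.
move=> [intf FE] [intg GE]; split.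
  exact: (@integrableD _ _ _ mu _ (measurable_itv _) _ _ intf intg).
move=> t tT; rewrite FE// GE// addrACA RintegralD//; exact: integrable_sub_itv.
Qed.

Lemma has_density_sum (I : Type) (r : seq I) (F f : I -> R -> R) :
  (forall i, has_density T (F i) (f i)) ->
  has_density T (fun t => \sum_(i <- r) F i t) (fun t => \sum_(i <- r) f i t).
Proof.
move=> Ff; elim: r => [|i r IH].
  by apply: eq_has_density (has_density_cst 0) => t _; rewrite /= big_nil.
by apply: eq_has_density (has_densityD (Ff i) IH) => t _; rewrite /= big_cons.
Qed.

Lemma has_densityM F f G g : has_density T F f -> has_density T G g ->
  has_density T (fun t => F t * G t) (fun t => F t * g t + G t * f t).
Proof.
move=> Ff Gg.
have cF := has_density_continuous Ff; have cG := has_density_continuous Gg.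
have [intf FE] := Ff; have [intg GE] := Gg.
have iFg := integrable_continuousM cF intg.
have iGf := integrable_continuousM cG intf.
have cprim h : mu.-integrable `[0, T] (EFin \o h) ->
    {within `[0, T], continuous (fun t => \int[mu]_(s in `[0, t]) h s)}.
  exact: (parameterized_integral_continuous T0).
split; first exact: (@integrableD _ _ _ mu _ (measurable_itv _) _ _ iFg iGf).
move=> t tT.
have t0 : 0 <= t by move: tT; rewrite in_itv => /andP[].
have mI : measurable (`[0, t]%classic : set R) by exact: measurable_itv.
have sub h := @integrable_sub_itv h t ^~ tT.
rewrite RintegralD//; [|exact: sub|exact: sub].
have E1 (H h K k : R -> R) : has_density T H h -> mu.-integrable `[0, T] (EFin \o k) ->
  \int[mu]_(s in `[0, t]) (H s * k s) = H 0 * \int[mu]_(s in `[0, t]) k s +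
    \int[mu]_(s in `[0, t]) (k s * \int[mu]_(r in `[0, s]) h r).
  move=> [inth HE] intk.
  have ikh : mu.-integrable `[0, T] (EFin \o (fun s => k s * \int[mu]_(r in `[0,
    s]) h r)).
    have := integrable_continuousM (cprim _ inth) intk.
    by apply: eq_integrable => // s _ /=; rewrite mulrC.
  rewrite -RintegralZl//; last exact: sub.
  rewrite -RintegralD//; last 2 first.
  - exact: (@integrableZl _ _ _ mu _ mI _ _ (sub _ intk)).
  - exact: sub.
  apply: eq_Rintegral => s /set_mem/(in_sub_itv tT) sT.
  by rewrite HE//; ring.
rewrite (E1 F f G g)// (E1 G g F f)// FE// GE//.
have expand (F0 G0 a b c e : R) : a * b = c + e ->
    (F0 + a) * (G0 + b) = F0 * G0 + (F0 * b + e + (G0 * a + c)).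
  by move=> ab; rewrite mulrDl !mulrDr ab; ring.
exact/expand/(Rintegral_product_triangle t0 (sub _ intf) (sub _ intg)).
Qed.

Lemma has_density_C1 F f : (forall t, is_derive t (1 : R) F (f t)) ->
  continuous f -> has_density T F f.
Proof.
move=> dF cf.
have cF : continuous F.
  by move=> t; apply: differentiable_continuous; apply/derivable1_diffP; case: (dF t).
split.
  apply: continuous_compact_integrable; first exact: segment_compact.
  exact: continuous_subspaceT.
move=> t; rewrite in_itv/= => /andP[]; rewrite le_eqVlt => /predU1P[<- _|t0 _].
  by rewrite set_itv1 Rintegral_set1 addr0.
rewrite /Rintegral (continuous_FTC2 t0 _ _ (F := F)).
- by rewrite -EFinB/= addrC subrK.
- exact: continuous_subspaceT.
- split.
  + by move=> x _; case: (dF x).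
  + exact: cvg_at_right_filter (cF _).
  + exact: cvg_at_left_filter (cF _).
- by move=> x _; rewrite derive1E; case: (dF x).
Qed.

End absolute_continuity.

(** * Matrix exponential *)

Section matrix_exponential.
Context {R : realType}.
Variable k : nat.
Implicit Types A : 'M[R]_k.

(** The sum [M] of all [|A a b|] dominates every row sum, which closes the induction. The entries of
    the exponential series are thereby dominated by the scalar series of [expR (M * |x|)]. *)
Lemma expmx_entry_bound A (l : nat) (i j : 'I_k) :
  `|(A ^+ l) i j| <= (\sum_a \sum_b `|A a b|) ^+ l.
Proof.
elim: l i j => [|l IH] i j.
  by rewrite !expr0 mxE; case: (_ == _); rewrite ?normr1 ?normr0.
set M := \sum_a _ in IH *.
have M0 : 0 <= M by apply: sumr_ge0 => a _; apply: sumr_ge0.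
rewrite exprS mxE (le_trans (ler_norm_sum _ _ _))// exprS.
apply: (@le_trans _ _ (\sum_a (`|A i a| * M ^+ l))).
  by apply: ler_sum => a _; rewrite normrM ler_wpM2l.
rewrite -mulr_suml ler_wpM2r// ?exprn_ge0//.
rewrite /M [leRHS](bigD1 i)//= lerDl; apply: sumr_ge0 => a _; exact: sumr_ge0.
Qed.

(** Each entry of [expm (x *: A)] is treated as a scalar power series in [x], so that termwise
    differentiation of [pseries] applies. *)
Definition expm_coeff A (i j : 'I_k) (l : nat) : R := (A ^+ l) i j / (l`!)%:R.

Lemma is_cvg_expm_coeff A i j (x : R) : cvgn (pseries (expm_coeff A i j) x).
Proof.
set M := \sum_a \sum_b `|A a b|.
apply: normed_cvg; apply: series_le_cvg (is_cvg_series_exp_coeff (M * `|x|)).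
- by move=> l; exact: normr_ge0.
- by move=> l; rewrite exp_coeffE mulr_ge0 ?invr_ge0// exprn_ge0// mulr_ge0//
  sumr_ge0// => a _; exact: sumr_ge0.
move=> l; rewrite exp_coeffE /expm_coeff exprMn /= normrM normrM normrX normfV.
rewrite [`|_%:R|]ger0_norm// mulrAC mulrC ler_wpM2l ?invr_ge0//.
by rewrite ler_wpM2r ?exprn_ge0// expmx_entry_bound.
Qed.

Lemma exprmxZ A (x : R) l : (x *: A) ^+ l = x ^+ l *: A ^+ l.
Proof.
elim: l => [|l IH]; first by rewrite !expr0 scale1r.
rewrite !exprS IH -[LHS]/(_ *m _) -[A * _]/(_ *m _).
by rewrite -scalemxAl -scalemxAr scalerA.
Qed.

Lemma expm_scaleE A (x : R) i j :
  expm (x *: A) i j = limn (pseries (expm_coeff A i j) x).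
Proof.
rewrite mxE; congr (limn (series _)); apply/funext => l.
by rewrite exprmxZ mxE /expm_coeff -mulrA mulrC.
Qed.

(** Differentiation turns the coefficient at [l] into [A ^+ l.+1 / l!]. Peeling off the extra factor
    [A] on the left, here, or on the right, in the next lemma, gives two forms of one series;
    comparing them proves [expm_comm]. *)
Lemma pseries_diffs_expm_coeff A i j :
  pseries_diffs (expm_coeff A i j) =
  fun l => \sum_a A i a * expm_coeff A a j l.
Proof.
apply/funext => l; rewrite /pseries_diffs /expm_coeff exprS mxE.
rewrite factS natrM invfM mulrCA mulVKf// mulr_suml.
by apply: eq_bigr => a _; rewrite mulrA.
Qed.

Lemma pseries_diffs_expm_coeffr A i j :
  pseries_diffs (expm_coeff A i j) =
  fun l => \sum_a A a j * expm_coeff A i a l.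
Proof.
apply/funext => l; rewrite /pseries_diffs /expm_coeff exprSr mxE.
rewrite factS natrM invfM mulrCA mulVKf// mulr_suml.
by apply: eq_bigr => a _; rewrite mulrA [A a j * _]mulrC.
Qed.

Lemma cvg_pseries_sum (c : 'I_k -> R) (e : 'I_k -> R^nat) (x : R) :
  (forall a, cvgn (pseries (e a) x)) ->
  pseries (fun l => \sum_a c a * e a l) x @ \oo -->
  \sum_a c a * limn (pseries (e a) x).
Proof.
move=> ce.
rewrite (_ : pseries _ x = fun l => \sum_a c a * pseries (e a) x l); last first.
  apply/funext => l; rewrite /pseries /series /=.
  under [RHS]eq_bigr do rewrite mulr_sumr.
  rewrite exchange_big/=; apply: eq_bigr => r _; rewrite mulr_suml.
  by apply: eq_bigr => a _; rewrite mulrA.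
apply: cvg_big => [|a _]; first exact: add_continuous.
  by apply: cvgMr; exact: ce.
Qed.

Lemma expm_comm A (x : R) : A *m expm (x *: A) = expm (x *: A) *m A.
Proof.
apply/matrixP => i j; rewrite !mxE.
under eq_bigr do rewrite expm_scaleE.
rewrite -(cvg_lim _ (cvg_pseries_sum (c := A i) (fun a => @is_cvg_expm_coeff A a j x)))//.
under [RHS]eq_bigr do rewrite expm_scaleE mulrC.
rewrite -(cvg_lim _ (cvg_pseries_sum (c := A^~ j) (fun a =>
  @is_cvg_expm_coeff A i a x)))//.
by rewrite -pseries_diffs_expm_coeff -pseries_diffs_expm_coeffr.
Qed.

Lemma is_derive_expm A (t : R) i j :
  is_derive t (1 : R) (fun s => expm (s *: A) i j) ((A *m expm (t *: A)) i j).
Proof.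
rewrite (_ : (fun s => _) = fun s => limn (pseries (expm_coeff A i j) s)); last first.
  by apply/funext => s; exact: expm_scaleE.
have diffs_cvg i' j' x : cvgn (pseries (pseries_diffs (expm_coeff A i' j')) x).
  rewrite pseries_diffs_expm_coeff; apply: cvgP (cvg_pseries_sum _) => a.
  exact: is_cvg_expm_coeff.
have -> : (A *m expm (t *: A)) i j = limn (pseries (pseries_diffs (expm_coeff A i j)) t).
  rewrite pseries_diffs_expm_coeff (cvg_lim _ (cvg_pseries_sum _))//; last first.
    by move=> a; exact: is_cvg_expm_coeff.
  by rewrite mxE; apply: eq_bigr => a _; rewrite expm_scaleE.
apply: (@pseries_snd_diffs _ _ (`|t| + 1)) => //.
- exact: is_cvg_expm_coeff.
- rewrite pseries_diffs_expm_coeff.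
  rewrite (_ : pseries_diffs _ = fun l => \sum_a A i a *
    pseries_diffs (expm_coeff A a j) l); last first.
    apply/funext => l; rewrite /pseries_diffs mulr_sumr.
    by apply: eq_bigr => a _; rewrite mulrCA.
  by apply: cvgP (cvg_pseries_sum _) => a.
- by rewrite [ltRHS]ger0_norm ?addr_ge0// ltrDl.
Qed.

Lemma expm0 A : expm (0 *: A) = 1%:M.
Proof.
apply/matrixP => i j; rewrite expm_scaleE; apply: cvg_lim => //.
rewrite -cvg_shiftS (_ : (fun l => _) = cst ((1%:M : 'M[R]_k) i j)); first exact: cvg_cst.
apply/funext => l; rewrite /pseries /series /= big_nat_recl//= big1 => [|m _].
  by rewrite /expm_coeff !expr0 mulr1 fact0 divr1 addr0.
by rewrite exprS mul0r mulr0.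
Qed.

Lemma continuous_expm A i j : continuous (fun s : R => expm (s *: A) i j).
Proof.
move=> t; apply: differentiable_continuous; apply/derivable1_diffP.
by case: (is_derive_expm A t i j).
Qed.

(* [r |-> expm ((s + t - r) *: A) *m expm (r *: A)] has derivative zero. *)
Lemma expmD A (s t : R) :
  expm ((s + t) *: A) = expm (s *: A) *m expm (t *: A).
Proof.
apply/matrixP => i j.
pose f r := \sum_a expm ((s + t - r) *: A) i a * expm (r *: A) a j.
have df r : is_derive r (1 : R) f 0.
  have du a : is_derive r (1 : R) (fun r => expm ((s + t - r) *: A) i a)
      (- (expm ((s + t - r) *: A) *m A) i a).
    have d1 : is_derive r (1 : R) (fun r => s + t - r) (-1).
      by apply: is_derive_eq; rewrite add0r mul1r.
    have := @is_derive1_comp _ (fun z => expm (z *: A) i a) (fun r => s + t -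
      r) r _ _ (is_derive_expm A (s + t - r) i a) d1.
    by move=> d2; apply: (is_derive_eq d2); rewrite expm_comm mulrN1.
  have dv a := is_derive_expm A r a j.
  rewrite (_ : f = \sum_a ((fun r => expm ((s + t - r) *: A) i a) * (fun r =>
    expm (r *: A) a j))); last first.
    by apply/funext => z; rewrite fct_sumE.
  apply: is_derive_eq.
  rewrite big_split/=; apply/eqP; rewrite addr_eq0; apply/eqP.
  transitivity ((expm ((s + t - r) *: A) *m A *m expm (r *: A)) i j).
    by rewrite -mulmxA [RHS]mxE.
  rewrite mxE -sumrN; apply: eq_bigr => a _.
  by rewrite /GRing.scale/= mulrN opprK mulrC.
have := is_derive_0_is_cst 0 t df.
rewrite /f subr0 addrK expm0.
move=> fE; rewrite -[expm ((s + t) *: A)]mulmx1.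
by rewrite mxE fE [RHS]mxE.
Qed.

End matrix_exponential.

(** * Linear dynamics and duality *)

Section dot_product.
Context {R : realType}.

Lemma dotE k (v w : 'cV[R]_k) : dot v w = \sum_i v i 0 * w i 0.
Proof. by rewrite /dot mxE; apply: eq_bigr => i _; rewrite mxE. Qed.

Lemma dotC k (v w : 'cV[R]_k) : dot v w = dot w v.
Proof. by rewrite !dotE; apply: eq_bigr => i _; rewrite mulrC. Qed.

Lemma dotDl k (v1 v2 w : 'cV[R]_k) : dot (v1 + v2) w = dot v1 w + dot v2 w.
Proof. by rewrite /dot linearD/= mulmxDl mxE. Qed.

Lemma dotDr k (v w1 w2 : 'cV[R]_k) : dot v (w1 + w2) = dot v w1 + dot v w2.
Proof. by rewrite /dot mulmxDr mxE. Qed.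

Lemma dotZl k (a : R) (v w : 'cV[R]_k) : dot (a *: v) w = a * dot v w.
Proof. by rewrite /dot linearZ/= -scalemxAl mxE. Qed.

Lemma dotZr k (a : R) (v w : 'cV[R]_k) : dot v (a *: w) = a * dot v w.
Proof. by rewrite dotC dotZl dotC. Qed.

Lemma dotNl k (v w : 'cV[R]_k) : dot (- v) w = - dot v w.
Proof. by rewrite -scaleN1r dotZl mulN1r. Qed.

Lemma dot_mulmxl k l (M : 'M[R]_(k, l)) (v : 'cV[R]_l) (w : 'cV[R]_k) :
  dot (M *m v) w = dot v (M^T *m w).
Proof. by rewrite /dot trmx_mul mulmxA. Qed.

Lemma dot_mulmxr k l (M : 'M[R]_(k, l)) (v : 'cV[R]_k) (w : 'cV[R]_l) :
  dot v (M *m w) = dot (M^T *m v) w.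
Proof. by rewrite dotC dot_mulmxl dotC. Qed.

End dot_product.

Section linear_dynamics.
Context {R : realType}.
Local Notation mu := (@lebesgue_measure R).

Lemma expm_tr k (A : 'M[R]_k) : expm A^T = (expm A)^T.
Proof.
have E l : A^T ^+ l = (A ^+ l)^T.
  elim: l => [|l IH]; first by rewrite !expr0 -[LHS]trmx1.
  by rewrite exprS IH exprSr -[LHS]/(_ *m _) -trmx_mul.
by apply/matrixP => i j; rewrite !mxE; congr (limn (series _)); apply/funext => l;
  rewrite E mxE.
Qed.

Lemma expmVN k (A : 'M[R]_k) (t : R) : expm (t *: A) *m expm (- t *: A) = 1%:M.
Proof. by rewrite -expmD addrN expm0. Qed.

Lemma mulmx_vint (T : R) k l (M : 'M[R]_(k, l)) (f : R -> 'cV[R]_l) :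
  (forall i, mu.-integrable `[0, T] (fun s => (f s i 0)%:E)) ->
  M *m vint `[0, T] f = vint `[0, T] (fun s => M *m f s).
Proof.
move=> intf; apply/matrixP => i j; rewrite !mxE.
transitivity (fine (\int[mu]_(s in `[0%R, T]) \sum_a ((M i a)%:E * (f s a 0)%:E))%E);
  last first.
  congr fine; apply: eq_integral => s _; rewrite mxE -sumEFin.
  by apply: eq_bigr => a _; rewrite EFinM.
rewrite integral_sum//; last by move=> a;
  exact: (@integrableZl _ _ _ mu _ (measurable_itv _)).
transitivity (fine (\sum_a (M i a * \int[mu]_(s in `[0, T]) f s a 0)%:E)).
  by rewrite sumEFin; apply: eq_bigr => a _; rewrite mxE.
congr fine; apply: eq_bigr => a _; rewrite integralZl// EFinM fineK//.
exact: integrable_fin_num.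
Qed.

Variables (T : R).
Hypothesis T0 : 0 <= T.

Lemma integrable_mulmx k l (M : 'M[R]_(k, l)) (f : R -> 'cV[R]_l) :
  (forall i, mu.-integrable `[0, T] (fun s => (f s i 0)%:E)) ->
  forall i, mu.-integrable `[0, T] (fun s => ((M *m f s) i 0)%:E).
Proof.
move=> intf i.
have : mu.-integrable `[0, T] (fun s => \sum_a ((M i a)%:E * (f s a 0)%:E))%E.
  apply: (@integrable_sum _ _ _ mu _ (measurable_itv _)) => a _.
  exact: (@integrableZl _ _ _ mu _ (measurable_itv _)).
by apply: eq_integrable => // s _; rewrite mxE sumEFin.
Qed.

Lemma integrable_cmulmx k l (M : R -> 'M[R]_(k, l)) (f : R -> 'cV[R]_l) :
  (forall i j, {within `[0, T], continuous (fun s => M s i j)}) ->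
  (forall i, mu.-integrable `[0, T] (fun s => (f s i 0)%:E)) ->
  forall i, mu.-integrable `[0, T] (fun s => ((M s *m f s) i 0)%:E).
Proof.
move=> cM intf i.
have : mu.-integrable `[0, T] (fun s => \sum_a ((M s i a * f s a 0)%:E))%E.
  apply: (@integrable_sum _ _ _ mu _ (measurable_itv _)) => a _.
  exact: (integrable_continuousM (cM i a) (intf a)).
by apply: eq_integrable => // s _; rewrite mxE sumEFin.
Qed.

Variables (k : nat) (A : 'M[R]_k) (f y : R -> 'cV[R]_k).
Hypothesis intf : forall i, mu.-integrable `[0, T] (fun s => (f s i 0)%:E).
Hypothesis cy : forall i, {within `[0, T], continuous (fun s => y s i 0)}.
Hypothesis yE : {in `[0, T], forall t,
  y t = vint `[0, t] (fun s => A *m y s + f s)}.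

Lemma scale_expmN (t : R) : expm (- t *: A) = expm (t *: - A).
Proof. by rewrite scaleNr scalerN. Qed.

Let y_density i : has_density T (fun t => y t i 0) (fun s => (A *m y s + f s) i 0).
Proof.
have y0 : y 0 i 0 = 0.
  by rewrite yE ?in_itv/= ?lexx// mxE set_itv1 Rintegral_set1.
split.
  have inty a : mu.-integrable `[0, T] (fun s => (y s a 0)%:E).
    apply: continuous_compact_integrable; first exact: segment_compact.
    exact: cy.
  have := @integrableD _ _ _ mu _ (measurable_itv _) _ _ (integrable_mulmx A inty i)
    (intf i).
  by apply: eq_integrable => // s _ /=; rewrite [X in _ = EFin X]mxE.
by move=> t tT; rewrite y0 add0r yE// mxE.
Qed.

(** Product rule with the integrating factor [expm (- t *: A)]: its derivative
    [- expm (- t *: A) *m A] cancels the drift [A *m y]. *)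
Lemma variation_of_constants i :
  has_density T (fun t => (expm (- t *: A) *m y t) i 0)
    (fun s => (expm (- s *: A) *m f s) i 0).
Proof.
have dE j : has_density T (fun t => expm (- t *: A) i j)
    (fun t => - (expm (- t *: A) *m A) i j).
  have : has_density T (fun t => expm (t *: - A) i j)
      (fun t => ((- A) *m expm (t *: - A)) i j).
    apply: has_density_C1 => // t.
    + exact: is_derive_expm.
    + rewrite (_ : (fun t => _) = fun t : R => \sum_a (- A) i a * expm (t *: - A) a j);
      last first.
        by apply/funext => s; rewrite mxE.
      apply: cvg_big => [|a _]; first exact: add_continuous.
      by apply: cvgMr; exact: continuous_expm.
  apply: eq_has_density => // t _; rewrite scale_expmN//.
  by rewrite expm_comm mulmxN mxE.
have := has_density_sum T0 (index_enum 'I_k)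
  (fun j => has_densityM T0 (dE j) (y_density j)).
apply: eq_has_density => // t _; first by rewrite mxE.
rewrite big_split/= -[X in X + _]/(\sum_j _).
have -> : \sum_j expm (- t *: A) i j * (A *m y t + f t) j 0 =
    (expm (- t *: A) *m (A *m y t + f t)) i 0 by rewrite [RHS]mxE.
have -> : \sum_j y t j 0 * - (expm (- t *: A) *m A) i j =
    - (expm (- t *: A) *m A *m y t) i 0.
  by rewrite mxE -sumrN; apply: eq_bigr => j _; rewrite mulrN mulrC.
by rewrite mulmxDr mulmxA mxE addrAC addrN add0r.
Qed.

Let z t := expm (- t *: A) *m y t.

Let zE t : t \in `[0, T] -> z t = vint `[0, t] (fun s => expm (- s *: A) *m f s).
Proof.
move=> tT; apply/matrixP => i j; rewrite ord1 /z (variation_of_constants i).2//.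
rewrite oppr0 expm0 mul1mx yE ?in_itv/= ?lexx// [X in X + _]mxE set_itv1.
by rewrite Rintegral_set1 add0r [RHS]mxE.
Qed.

(** Serves as uniqueness: the right-hand side involves [A] and [f] only, so two solutions with the
    same forcing agree. This makes the difference quotients of the states independent of the size of
    the perturbation. *)
Lemma linear_stateE : {in `[0, T], forall t,
  y t = expm (t *: A) *m vint `[0, t] (fun s => expm (- s *: A) *m f s)}.
Proof. by move=> t tT; rewrite -zE// /z mulmxA expmVN mul1mx. Qed.

(* For [xi = adjoint] and [g] the gradient of the running cost in the state, the
   costate is [expm (- t *: A^T) *m q t]. *)
Variables (g : R -> 'cV[R]_k) (xi : 'cV[R]_k).
Hypothesis intg : forall i, mu.-integrable `[0, T] (fun s => (g s i 0)%:E).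

Let q t := xi - vint `[0, t] (fun s => expm (s *: A^T) *m g s).

Let intEg i : mu.-integrable `[0, T] (fun s => ((expm (s *: A^T) *m g s) i 0)%:E).
Proof.
by apply: integrable_cmulmx => // a b; apply: continuous_subspaceT;
  exact: continuous_expm.
Qed.

Let q_density i : has_density T (fun t => q t i 0)
  (fun s => - (expm (s *: A^T) *m g s) i 0).
Proof.
split; first by have := integrableN (intEg i).
move=> t tT; rewrite !mxE set_itv1 Rintegral_set1 subr0; congr (_ + _).
under [RHS]eq_Rintegral do rewrite -mulN1r.
rewrite RintegralZl//; last exact: (integrable_sub_itv (intEg i)).
by rewrite mulN1r.
Qed.

(** Product rule for [q] and [z]. In the term with the derivative of [q], the factor
    [expm (t *: A^T)], transposed, meets the factor [expm (- t *: A)] of [z] and cancels it, which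
    leaves [dot (g t) (y t)]. *)
Lemma dual_density :
  has_density T (fun t => dot (q t) (z t))
    (fun s => dot (expm (- s *: A^T) *m q s) (f s) - dot (g s) (y s)).
Proof.
have := has_density_sum T0 (index_enum 'I_k)
  (fun i => has_densityM T0 (q_density i) (variation_of_constants i)).
apply: eq_has_density => // t _; first by rewrite dotE.
rewrite big_split/=; congr (_ + _).
  rewrite -dotE -linearZ/= expm_tr -dot_mulmxr//.
rewrite (_ : \sum_i _ = - dot (expm (t *: A^T) *m g t) (z t)); last first.
  by rewrite dotE -sumrN; apply: eq_bigr => i _; rewrite mulrN mulrC.
congr (- _); rewrite /z -linearZ/= expm_tr dot_mulmxl trmxK mulmxA expmVN mul1mx//.
Qed.

End linear_dynamics.

(** * Pathwise derivative of the cost exponent *)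

Section square_integrable_paths.
Context {R : realType}.
Local Notation mu := (@lebesgue_measure R).
Variable T : R.

Definition square_integrable (f : R -> R) : Prop :=
  measurable_fun `[0, T] f /\
  mu.-integrable `[0, T] (fun s => ((f s) ^+ 2)%:E).

Definition square_integrable_path k (v : R -> 'cV[R]_k) : Prop :=
  forall i, square_integrable (fun s => v s i 0).

Lemma square_integrableM f g : square_integrable f -> square_integrable g ->
  mu.-integrable `[0, T] (fun s => (f s * g s)%:E).
Proof.
move=> [mf f2] [mg g2].
have fg2 := @integrableD _ _ _ mu _ (measurable_itv _) _ _ f2 g2.
apply: (@le_integrable _ _ _ mu _ (measurable_itv _) _ _ _ _ fg2).
  by apply/measurable_EFinP; exact: measurable_funM.
move=> s _; rewrite -EFinD !abse_EFin lee_fin [leRHS]ger0_norm ?addr_ge0 ?sqr_ge0//.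
rewrite ler_norml; have := sqr_ge0 (f s + g s); have := sqr_ge0 (f s - g s).
by move=> h1 h2; apply/andP; split; nra.
Qed.

Lemma continuous_square_integrable f : {within `[0, T], continuous f} ->
  square_integrable f.
Proof.
move=> cf; split; first exact: subspace_continuous_measurable_fun.
apply: continuous_compact_integrable; first exact: segment_compact.
by move=> x; apply: cvgM; exact: cf.
Qed.

Lemma square_integrable_int f : square_integrable f ->
  mu.-integrable `[0, T] (fun s => (f s)%:E).
Proof.
move=> sf; have s1 : square_integrable (cst 1).
  by apply: continuous_square_integrable => x; exact: cvg_cst.
have := square_integrableM sf s1.
by apply: eq_integrable => // s _; rewrite mulr1.
Qed.

Lemma square_integrableZ a f : square_integrable f ->
  square_integrable (fun s => a * f s).
Proof.
move=> [mf f2]; split; first exact: measurable_funM.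
have := @integrableZl _ _ _ mu _ (measurable_itv _) (a ^+ 2) _ f2.
by apply: eq_integrable => // s _; rewrite exprMn EFinM.
Qed.

Lemma square_integrableD f g : square_integrable f -> square_integrable g ->
  square_integrable (fun s => f s + g s).
Proof.
move=> sf sg; have fg := square_integrableM sf sg.
have [mf f2] := sf; have [mg g2] := sg.
split; first exact: measurable_funD.
have fg2 := @integrableZl _ _ _ mu _ (measurable_itv _) 2 _ fg.
have := @integrableD _ _ _ mu _ (measurable_itv _) _ _ f2 (@integrableD _ _ _ mu _
  (measurable_itv _) _ _ fg2 g2).
by apply: eq_integrable => // s _; rewrite /= -EFinM -!EFinD sqrrD addrA mulr_natl.
Qed.

Lemma square_integrable_sum (I : Type) (r : seq I) (f : I -> R -> R) :
  (forall i, square_integrable (f i)) ->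
  square_integrable (fun s => \sum_(i <- r) f i s).
Proof.
move=> sf; elim: r => [|i r IH].
  under eq_fun do rewrite big_nil.
  by apply: continuous_square_integrable => x; exact: cvg_cst.
by under eq_fun do rewrite big_cons; exact: square_integrableD.
Qed.

Lemma square_integrable_pathD k (v w : R -> 'cV[R]_k) :
  square_integrable_path v -> square_integrable_path w ->
  square_integrable_path (fun s => v s + w s).
Proof.
by move=> sv sw i; under eq_fun do rewrite mxE; exact: square_integrableD.
Qed.

Lemma square_integrable_path_cst k (v : 'cV[R]_k) :
  square_integrable_path (fun=> v).
Proof. by move=> i; apply: continuous_square_integrable => x; exact: cvg_cst. Qed.

Lemma square_integrable_path_mulmx k l (M : 'M[R]_(k, l)) (v : R -> 'cV[R]_l) :
  square_integrable_path v -> square_integrable_path (fun s => M *m v s).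
Proof.
move=> sv i; under eq_fun do rewrite mxE.
by apply: square_integrable_sum => a; exact: square_integrableZ.
Qed.

Lemma integrable_dot k (v w : R -> 'cV[R]_k) :
  square_integrable_path v -> square_integrable_path w ->
  mu.-integrable `[0, T] (fun s => (dot (v s) (w s))%:E).
Proof.
move=> sv sw.
have : mu.-integrable `[0, T] (fun s => \sum_i ((v s i 0 * w s i 0)%:E))%E.
  apply: (@integrable_sum _ _ _ mu _ (measurable_itv _)) => i _.
  exact: square_integrableM.
by apply: eq_integrable => // s _; rewrite dotE sumEFin.
Qed.

End square_integrable_paths.

(** The expression is the difference quotient at 0 of [e |-> expR (e * a + e ^+ 2 * b)]. *)
Lemma cvg_expR_quotient (R : realType) (a b : R) :
  e^-1 * (expR (e * a + e ^+ 2 * b) - 1) @[e --> 0^'] --> a.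
Proof.
have d : is_derive (0 : R) (1 : R) (fun e => expR (e * a + e ^+ 2 * b)) a.
  have d1 : is_derive (0 : R) (1 : R) (fun e => e * a + e ^+ 2 * b) a.
    have d1 : is_derive (0 : R) (1 : R) ((id * cst a) + (id ^+ 2 * cst b) : R -> R) a.
      have did := @is_derive_id R R 0 1.
      have dcst c := @is_derive_cst R R R c 0 1.
      apply: (is_derive_eq (is_deriveD (is_deriveM did (dcst a))
        (is_deriveM (is_deriveX 2 did) (dcst b)))).
      by rewrite /GRing.scale/= /cst !mulr0 !mul0r mulr0 addr0 add0r mulr1 addr0.
    exact: d1.
  have := @is_derive1_comp _ expR (fun e => e * a + e ^+ 2 *
    b) 0 _ _ (is_derive_expR _) d1.
  by move=> d2; apply: (is_derive_eq d2); rewrite mul0r expr0n/= mul0r addr0 expR0 mul1r.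
have [dv dE] := d; move: (dv); rewrite /derivable -[X in X @ _]/(fun h => _).
move=> dv'; rewrite -[X in _ --> X]dE /derive.
apply: cvg_trans dv'.
apply: near_eq_cvg; near=> h.
by rewrite /= addr0 [h%:A]mulr1 mul0r expr0n/= mul0r addr0 expR0.
Unshelve. all: by end_near. Qed.

Section cost_variation.
Context {R : realType} {d : measure_display} {Omega : measurableType d}.
Context {n m r : nat} (p : lqg R n m r).
Local Notation mu := (@lebesgue_measure R).
Local Notation T := (hor p).
Variables (x xe : vprocess (R := R) (Omega := Omega) n).
Variables (u omega : vprocess (R := R) (Omega := Omega) m) (o : Omega).
Variables (y : R -> 'cV[R]_n) (e : R).
Hypothesis su : square_integrable_path T (u^~ o).
Hypothesis so : square_integrable_path T (omega^~ o).
Hypothesis sx : square_integrable_path T (x^~ o).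
Hypothesis sy : square_integrable_path T y.
Hypothesis xeE : {in `[0, T], forall t, xe t o = x t o + e *: y t}.

(** The coefficient of [e] in [Lambda] along [x + e y] and [u + e omega]. The cross term
    [2 <S u, x>] of the cost contributes [S u] to the factor of [y] and [S^T x] to that of
    [omega]. *)
Definition first_variation (x : vprocess (R := R) (Omega := Omega) n)
    (u omega : vprocess (R := R) (Omega := Omega) m)
    (o : Omega) (y : R -> 'cV[R]_n) : R :=
  \int[mu]_(s in `[0, T])
    (dot (Q_ p *m x s o + S_ p *m u s o - eta_ p) (y s) +
     dot (R_ p *m u s o + (S_ p)^T *m x s o - zeta_ p) (omega s o)) +
  dot (Qhat_ p *m x T o) (y T).

Definition second_variation (omega : vprocess (R := R) (Omega := Omega) m)
    (o : Omega) (y : R -> 'cV[R]_n) : R :=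
  2^-1 * \int[mu]_(s in `[0, T])
    (dot (Q_ p *m y s) (y s) + 2 * dot (S_ p *m omega s o) (y s) +
     dot (R_ p *m omega s o) (omega s o)) +
  2^-1 * dot (Qhat_ p *m y T) (y T).

Let quadraticE k (M : 'M[R]_k) (v w : 'cV[R]_k) : M^T = M ->
  dot (M *m (v + e *: w)) (v + e *: w) =
  dot (M *m v) v + e * (2 * dot (M *m v) w) + e ^+ 2 * dot (M *m w) w.
Proof.
move=> MT; rewrite mulmxDr -scalemxAr !dotDl !dotDr !dotZl !dotZr.
have -> : dot (M *m w) v = dot (M *m v) w by rewrite dot_mulmxl MT dotC.
by ring.
Qed.

Lemma Lambda_perturb : Lambda p xe (perturb u omega e) o =
  Lambda p x u o + e * first_variation x u omega o y +
  e ^+ 2 * second_variation omega o y.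
Proof.
have T0 : 0 <= T by rewrite ltW// hor_gt0.
have Tin : T \in `[0, T] by rewrite in_itv/= T0 lexx.
rewrite /Lambda /first_variation /second_variation xeE// quadraticE ?Qhat_sym//.
pose g s := Q_ p *m x s o + S_ p *m u s o - eta_ p.
pose h s := R_ p *m u s o + (S_ p)^T *m x s o - zeta_ p.
pose F1 s := dot (g s) (y s) + dot (h s) (omega s o).
pose F2 s := dot (Q_ p *m y s) (y s) + 2 * dot (S_ p *m omega s o) (y s) +
  dot (R_ p *m omega s o) (omega s o).
pose F0 s := dot (Q_ p *m x s o) (x s o) + 2 * dot (S_ p *m u s o) (x s o) +
  dot (R_ p *m u s o) (u s o) - 2 * dot (eta_ p) (x s o) - 2 * dot (zeta_ p) (u s o).
rewrite -/(\int[mu]_(s in `[0, T]) F0 s) -/(\int[mu]_(s in `[0, T]) F1 s).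
rewrite -/(\int[mu]_(s in `[0, T]) F2 s).
have sQx := square_integrable_path_mulmx (Q_ p) sx.
have sQy := square_integrable_path_mulmx (Q_ p) sy.
have sSu := square_integrable_path_mulmx (S_ p) su.
have sSo := square_integrable_path_mulmx (S_ p) so.
have sSx := square_integrable_path_mulmx (S_ p)^T sx.
have sRu := square_integrable_path_mulmx (R_ p) su.
have sRo := square_integrable_path_mulmx (R_ p) so.
have iD (f1 f2 : R -> R) : mu.-integrable `[0, T] (EFin \o f1) ->
    mu.-integrable `[0, T] (EFin \o f2) ->
    mu.-integrable `[0, T] (EFin \o (fun s => f1 s + f2 s)).
  by move=> i1 i2; exact: (@integrableD _ _ _ mu _ (measurable_itv _) _ _ i1 i2).
have iZ c (f1 : R -> R) : mu.-integrable `[0, T] (EFin \o f1) ->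
    mu.-integrable `[0, T] (EFin \o (fun s => c * f1 s)).
  by move=> i1; exact: (@integrableZl _ _ _ mu _ (measurable_itv _) c _ i1).
have iN (f1 : R -> R) : mu.-integrable `[0, T] (EFin \o f1) ->
    mu.-integrable `[0, T] (EFin \o (fun s => - f1 s)).
  by move=> i1; have := integrableN i1.
have iF1 : mu.-integrable `[0, T] (EFin \o F1).
  apply: (iD); apply: integrable_dot => //.
  - apply: square_integrable_pathD; first exact: square_integrable_pathD.
    exact: square_integrable_path_cst.
  - apply: square_integrable_pathD; first exact: square_integrable_pathD.
    exact: square_integrable_path_cst.
have iF2 : mu.-integrable `[0, T] (EFin \o F2).
  by apply: (iD); [apply: (iD); [|apply: (iZ)]|]; exact: integrable_dot.
have iF0 : mu.-integrable `[0, T] (EFin \o F0).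
  apply: (iD); [apply: (iD); [apply: (iD); [apply: (iD); [|apply: (iZ)]|]|apply: (iN);
    apply: (iZ)]|apply: (iN); apply: (iZ)];
    apply: integrable_dot => //; exact: square_integrable_path_cst.
transitivity (2^-1 * (\int[mu]_(s in `[0, T]) (F0 s + e * (2 * F1 s) + e ^+ 2 * F2 s)) +
  2^-1 * (dot (Qhat_ p *m x T o) (x T o) + e * (2 * dot (Qhat_ p *m x T o) (y T)) +
   e ^+ 2 * dot (Qhat_ p *m y T) (y T))).
  congr (_ * _ + _); apply: eq_Rintegral => s /set_mem sT; rewrite xeE//.
  rewrite quadraticE ?Q_sym// quadraticE ?R_sym// /F0 /F1 /F2 /g /h /perturb.
  rewrite mulmxDr -scalemxAr !dotDl !dotDr !dotZl !dotZr !dotNl.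
  (* The first variation pairs [S^T x] with [omega], whereas the expanded cost contains
     [<S omega, x>]; both are brought to the second form. *)
  rewrite [dot ((S_ p)^T *m _) _]dot_mulmxl trmxK [dot (x s o) (S_ p *m _)]dotC.
  by ring.
rewrite RintegralD//; [|apply: (iD) => //; do 2 apply: (iZ) => //|exact: iZ].
rewrite RintegralD//; [|by do 2 apply: (iZ)].
rewrite !RintegralZl//; [|exact: iZ].
by field.
Qed.

End cost_variation.

Section gateaux_derivative.
Context {R : realType} {d : measure_display} {Omega : measurableType d}.
Context {n m r : nat} (p : lqg R n m r).
Local Notation mu := (@lebesgue_measure R).
Local Notation T := (hor p).
Local Notation A := (A_ p).
Local Notation B := (B_ p).
Variables (x0 : Omega -> 'cV[R]_n) (N : vprocess (R := R) (Omega := Omega) n).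
Variable X : vprocess (R := R) (Omega := Omega) m -> vprocess (R := R) (Omega := Omega) n.
Variables (u omega : vprocess (R := R) (Omega := Omega) m) (o : Omega).
Hypothesis su : square_integrable_path T (u^~ o).
Hypothesis so : square_integrable_path T (omega^~ o).
Hypothesis stu : state p x0 N u (X u).
Hypothesis ste : forall e, state p x0 N (perturb u omega e) (X (perturb u omega e)).

Let T0 : 0 <= T. Proof. by rewrite ltW// hor_gt0. Qed.
Let Tin : T \in `[0, T]. Proof. by rewrite in_itv/= T0 lexx. Qed.

Lemma gradientZ (x : vprocess (R := R) (Omega := Omega) n) (c a : R) (v : 'cV[R]_n) t :
  gradient p x u (c * a) (c *: v) t o = c *: gradient p x u a v t o.
Proof.
by rewrite /gradient [RHS]scalerDr scalerA -!scalemxAr.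
Qed.

Let intB i : mu.-integrable `[0, T] (fun s => ((B *m omega s o) i 0)%:E).
Proof.
exact: square_integrable_int (square_integrable_path_mulmx B so i).
Qed.

Let contX i : {within `[0, T], continuous (fun t => X u t o i 0)}.
Proof.
have [_ /(_ o) [|+ _]] := stu; last exact.
by move=> j; exact: square_integrable_int (su j).
Qed.

Let sX : square_integrable_path T ((X u)^~ o).
Proof. by move=> i; exact: continuous_square_integrable. Qed.

(** [dual_density] at time [T], with [xi] the adjoint. The boundary term at 0 vanishes with [y 0].
    At [T] the integral in the adjoint cancels, so that [q T] is [expm (T *: A^T) *m (Qhat x_T)] and
    the boundary term is [<Qhat x_T, y_T>], the terminal part of the first variation. The integrals
    of [<g, y>] then cancel. *)
Lemma first_variationE (y : R -> 'cV[R]_n) :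
  (forall i, {within `[0, T], continuous (fun s => y s i 0)}) ->
  {in `[0, T], forall t, y t = vint `[0, t] (fun s => A *m y s + B *m omega s o)} ->
  first_variation p (X u) u omega o y =
  \int[mu]_(t in `[0, T])
    dot (omega t o) (gradient p (X u) u 1 (adjoint p (X u) u o) t o).
Proof.
move=> cy yE.
pose g s := Q_ p *m X u s o + S_ p *m u s o - eta_ p.
pose h s := R_ p *m u s o + (S_ p)^T *m X u s o - zeta_ p.
have sg : square_integrable_path T g.
  apply: square_integrable_pathD; last exact: square_integrable_path_cst.
  by apply: square_integrable_pathD; exact: square_integrable_path_mulmx.
have sh : square_integrable_path T h.
  apply: square_integrable_pathD; last exact: square_integrable_path_cst.
  by apply: square_integrable_pathD; exact: square_integrable_path_mulmx.
have ig i : mu.-integrable `[0, T] (fun s => (g s i 0)%:E).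
  exact: square_integrable_int (sg i).
have sy : square_integrable_path T y.
  by move=> i; exact: continuous_square_integrable.
pose xi := adjoint p (X u) u o.
pose q t := xi - vint `[0, t] (fun s => expm (s *: A^T) *m g s).
have [intD DE] := dual_density T0 intB cy yE xi ig.
have igy := integrable_dot sg sy.
have iho := integrable_dot sh so.
have hT := DE _ Tin.
have y00 : y 0 = 0.
  rewrite (yE 0) ?in_itv/= ?lexx// set_itv1.
  by apply/matrixP => i j; rewrite !mxE Rintegral_set1.
rewrite /first_variation.
transitivity (\int[mu]_(s in `[0, T]) dot (g s) (y s) +
  \int[mu]_(s in `[0, T]) dot (h s) (omega s o) +
  (\int[mu]_(s in `[0, T]) (dot (expm (- s *: A^T) *m q s) (B *m omega s o) -
    dot (g s) (y s)))).
  rewrite RintegralD//; congr (_ + _).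
  move: hT; rewrite [X in _ = X + _](_ : _ = 0) ?add0r; last first.
    by rewrite y00 mulmx0 /dot mulmx0 mxE.
  move=> <-; rewrite /xi /adjoint addrK.
  by rewrite -linearZ/= expm_tr [RHS]dot_mulmxl trmxK mulmxA expmVN mul1mx.
have iqo : mu.-integrable `[0,
  T] (fun s => (dot (expm (- s *: A^T) *m q s) (B *m omega s o))%:E).
  have := @integrableD _ _ _ mu _ (measurable_itv _) _ _ intD igy.
  by apply: eq_integrable => // s _; rewrite /= -EFinD subrK.
rewrite RintegralB// addrC addrA subrK -RintegralD//.
apply: eq_Rintegral => t /set_mem tT.
have t0 : 0 <= t by have : t \in `[0, T] := tT; rewrite in_itv => /andP[].
have gE : {in `[0, t]%classic, forall s, expm ((s - t) *: A^T) *m g s =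
    expm (- t *: A^T) *m (expm (s *: A^T) *m g s)}.
  by move=> s _; rewrite mulmxA -expmD addrC.
(* The factor [expm (- t *: A^T)] comes out of the memory integral, which then merges with the
   adjoint into [q t]. *)
have -> : gradient p (X u) u 1 xi t o = B^T *m (expm (- t *: A^T) *m q t) + h t.
  rewrite /gradient scale1r -/(h t) /q.
  have -> : vint `[0, t] (fun s => expm ((s - t) *: A^T) *m
      (Q_ p *m X u s o + S_ p *m u s o - eta_ p)) =
      expm (- t *: A^T) *m vint `[0, t] (fun s => expm (s *: A^T) *m g s).
    rewrite mulmx_vint; last first.
      move=> i; apply: (integrable_sub_itv _ tT).
      by apply: integrable_cmulmx => // a b; apply: continuous_subspaceT;
        exact: continuous_expm.
    apply/matrixP => i j; rewrite !mxE; apply: eq_Rintegral => s sT.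
    by rewrite -/(g s) gE.
  by rewrite !mulmxBr addrA addrAC.
by rewrite dotDr [dot (omega t o) (_ *m _)]dot_mulmxr trmxK [dot (h t) _]dotC [dot (B
  *m _) _]dotC.
Qed.

Lemma diff_quot_cvg :
  diff_quot p X u omega e o @[e --> 0^'] -->
  weight p (X u) u o * (risk p * \int[mu]_(t in `[0, T])
    dot (omega t o) (gradient p (X u) u 1 (adjoint p (X u) u o) t o)).
Proof.
have se e : square_integrable_path T ((perturb u omega e)^~ o).
  apply: square_integrable_pathD => // i.
  have := square_integrableZ e (so i).
  by congr square_integrable; apply/funext => s; rewrite mxE.
have inte e i : mu.-integrable `[0, T] (fun s => (perturb u omega e s o i 0)%:E).
  exact: square_integrable_int (se e i).
pose y e t := e^-1 *: (X (perturb u omega e) t o - X u t o).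
have cXe e i : {within `[0, T], continuous (fun t => X (perturb u omega e) t o i 0)}.
  by have [_ /(_ o (inte e)) [+ _]] := ste e; exact.
have cy e i : {within `[0, T], continuous (fun t => y e t i 0)}.
  rewrite (_ : (fun t => _) = fun t => e^-1 * (X (perturb u omega e) t o i 0 -
    X u t o i 0)); last first.
    by apply/funext => t; rewrite !mxE.
  by move=> t; apply: cvgMr; apply: cvgB; [exact: cXe|exact: contX].
have intu i : mu.-integrable `[0, T] (fun s => (u s o i 0)%:E).
  exact: square_integrable_int (su i).
have cint (v : R -> 'cV[R]_n) i : {within `[0, T], continuous (fun t => v t i 0)} ->
    mu.-integrable `[0, T] (fun t => (v t i 0)%:E).
  by move=> cv; apply: continuous_compact_integrable => //; exact: segment_compact.
have irhs (v : R -> 'cV[R]_m) (z : R -> 'cV[R]_n) :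
    (forall i, mu.-integrable `[0, T] (fun s => (v s i 0)%:E)) ->
    (forall i, mu.-integrable `[0, T] (fun s => (z s i 0)%:E)) ->
    forall i, mu.-integrable `[0, T] (EFin \o (fun s => (A *m z s + B *m v s +
      b_ p s) i 0)).
  move=> iv iz i.
  have := @integrableD _ _ _ mu _ (measurable_itv _) _ _
    (@integrableD _ _ _ mu _ (measurable_itv _) _ _ (integrable_mulmx A iz i)
      (integrable_mulmx B iv i))
    (cint _ i (@b_cont _ _ _ _ p i)).
  by apply: eq_integrable => // s _ /=; rewrite !mxE.
(* Both states start from [x0] and are driven by the same noise path [N]; these and [b] cancel in
   the difference. *)
have yE e : e != 0 -> {in `[0, T], forall t,
    y e t = vint `[0, t] (fun s => A *m y e s + B *m omega s o)}.
  move=> e0 t tT; have tT' : 0 <= t <= T by move: tT; rewrite in_itv.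
  rewrite /y; have [_ /(_ o (inte e)) [_ ->//]] := ste e.
  have [_ /(_ o intu) [_ ->//]] := stu.
  have cancel (a b1 b2 c : 'cV[R]_n) :
      a + b1 + c - (a + b2 + c) = b1 - b2.
    by rewrite opprD addrACA subrr addr0 opprD addrACA subrr add0r.
  rewrite cancel.
  apply/matrixP => i j; rewrite ord1 mxE [X in _ * X]mxE [X in _ + X]mxE.
  have i1 := integrable_sub_itv (irhs _ _ (inte e) (fun a => cint _ a (cXe e a)) i) tT.
  have i2 := integrable_sub_itv (irhs _ _ intu (fun a => cint _ a (@contX a)) i) tT.
  rewrite ![vint _ _ i 0]mxE -RintegralB//.
  have i3 := @integrableB _ _ _ mu _ (measurable_itv _) _ _ i1 i2.
  rewrite -RintegralZl//.
  apply: eq_Rintegral => s _.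
  have -> : A *m (e^-1 *: (X (perturb u omega e) s o - X u s o)) + B *m omega s o =
      e^-1 *: ((A *m X (perturb u omega e) s o + B *m perturb u omega e s o + b_ p s) -
        (A *m X u s o + B *m u s o + b_ p s)).
    rewrite /perturb [B *m (_ + _)]mulmxDr -!scalemxAr opprD [in RHS]addrACA addrN addr0.
    rewrite opprD [in RHS]addrACA [B *m _ +
      _]addrC addrK scalerDr scalerA mulVf// scale1r.
    by rewrite mulmxBr.
  by rewrite [RHS]mxE; congr (_ * _); rewrite [RHS]mxE; congr (_ + _); rewrite [RHS]mxE.
(* The difference quotient of the states does not depend on [e], so the cost
   exponent is an exact quadratic polynomial in [e]. *)
have yU e : e != 0 -> {in `[0, T], forall t, y e t = y 1 t}.
  move=> e0 t tT.
  by rewrite (linear_stateE T0 intB (cy e) (yE e e0) tT) (linear_stateE T0 intB (cy 1)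
    (yE 1 (oner_neq0 _)) tT).
have XE e : e != 0 -> {in `[0, T], forall t,
  X (perturb u omega e) t o = X u t o + e *: y 1 t}.
  by move=> e0 t tT; rewrite -(yU e)// /y scalerA mulfV// scale1r addrC subrK.
have sy1 : square_integrable_path T (y 1) by move=> i;
  exact: continuous_square_integrable.
rewrite -(first_variationE (cy 1) (yE 1 (oner_neq0 _))).
set L := first_variation _ _ _ _ _ _; pose q := second_variation p omega o (y 1).
have cL : weight p (X u) u o *
    (e^-1 * (expR (e * (risk p * L) + e ^+ 2 * (risk p * q)) - 1)) @[e --> 0^'] -->
    weight p (X u) u o * (risk p * L).
  by apply: cvgMr; exact: cvg_expR_quotient.
apply: cvg_trans cL; apply: near_eq_cvg.
near=> e.
have e0 : e != 0 by near: e; exact: nbhs_dnbhs_neq.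
rewrite /diff_quot (Lambda_perturb su so sX sy1 (XE e e0)) -/L -/q /=.
by congr (_ * (_ * (expR _ - 1))); ring.
Unshelve. all: by end_near. Qed.

End gateaux_derivative.

(** * Completion of a sigma-algebra *)

Section completion.
Context {d} {Omega : measurableType d} {R : realType}.
Variable P : probability Omega R.
Variable G : set (set Omega).
Hypothesis sG : sigma_algebra [set: Omega] G.
Hypothesis mG : G `<=` measurable.

Lemma integral_indicE (E : set Omega) (f : Omega -> R) :
  (\int[P]_(o in E) (f o)%:E = \int[P]_o (f o * \1_E o)%:E)%E.
Proof.
rewrite integral_mkcond; apply: eq_integral => o _.
by rewrite patchE indicE; case: (o \in E); rewrite ?mulr1 ?mulr0.
Qed.

(** The test functions of the duality argument. The difference [Y - Z] is one of them whenever [Y]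
    is a version of the conditional expectation of [Z] given [G]. *)
Definition orthogonal_to (xi : Omega -> R) : Prop :=
  P.-integrable setT (EFin \o xi) /\
  forall E, G E -> (\int[P]_(o in E) (xi o)%:E = 0)%E.

(* The completion of [G] within the measurable sets, characterized by duality, so
   that no conditional expectation has to be constructed. *)
Definition completion : set (set Omega) := [set E | measurable E /\
  forall xi, orthogonal_to xi -> (\int[P]_(o in E) (xi o)%:E = 0)%E].

Lemma sub_completion : G `<=` completion.
Proof. by move=> E GE; split; [exact: mG|move=> xi [_]; exact]. Qed.

Lemma integrable_indicM (xi : Omega -> R) E : measurable E ->
  P.-integrable setT (EFin \o xi) ->
  P.-integrable setT (EFin \o (fun o => xi o * \1_E o)).
Proof.
move=> mE ixi.
have /(integrable_mkcond _ mE) : P.-integrable E (EFin \o xi) by exact: integrableS ixi.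
apply: eq_integrable => // o _; rewrite patchE/= indicE.
by case: (o \in E); rewrite ?mulr1 ?mulr0.
Qed.

Let GI E F : G E -> G F -> G (E `&` F).
Proof.
case: sG => G0 GC GU GE GF.
rewrite -[_ `&` _]setCK setCI -bigcup2E -setTD; apply: (GC).
apply: (GU) => -[|[|k]] /=; rewrite -?setTD; [exact: (GC)|exact: (GC)|exact: (G0)].
Qed.

(** A bootstrap: for [F] in [G], [xi * \1_F] is orthogonal because [G] is stable under intersection,
    and the defining property of [E] can then be applied to [xi * \1_F]. Stability of the completion
    under intersection follows. *)
Lemma orthogonal_indicM xi E : orthogonal_to xi -> completion E ->
  orthogonal_to (fun o => xi o * \1_E o).
Proof.
have step xi' F : orthogonal_to xi' -> G F -> orthogonal_to (fun o => xi' o * \1_F o).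
  move=> [ixi xi0] GF; split; first exact: integrable_indicM (mG GF) ixi.
  move=> E' GE'; rewrite -[RHS](xi0 _ (GI GF GE')) [LHS]integral_indicE
    [RHS]integral_indicE.
  by apply: eq_integral => o _; rewrite indicI -mulrA [in RHS]/=.
move=> oxi [mE cE]; split; first exact: integrable_indicM mE oxi.1.
move=> F GF; rewrite -[RHS](cE _ (step _ _ oxi GF)) [LHS]integral_indicE
  [RHS]integral_indicE.
by apply: eq_integral => o _; rewrite mulrAC.
Qed.

Lemma completionI E F : completion E -> completion F -> completion (E `&` F).
Proof.
move=> cE cF; split; first exact: measurableI cE.1 cF.1.
move=> xi oxi; rewrite -[RHS](cF.2 _ (orthogonal_indicM oxi cE)) [LHS]integral_indicE
  [RHS]integral_indicE.
by apply: eq_integral => o _; rewrite indicI mulrA.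
Qed.

Let GT : G setT.
Proof. by case: sG => G0 GC _; rewrite -(setD0 setT); exact: GC. Qed.

Lemma completionC E : completion E -> completion (~` E).
Proof.
move=> [mE cE]; split; first exact: measurableC.
move=> xi oxi; have ixi := oxi.1.
have := oxi.2 _ GT; rewrite -(setUv E) integral_setU//; last 3 first.
- exact: measurableC.
- by rewrite setUv; exact: measurable_int ixi.
- by rewrite disj_set2E setICr.
by rewrite cE// add0e.
Qed.

Lemma completion_bigcup (F : (set Omega)^nat) :
  (forall k, completion (F k)) -> completion (\bigcup_k F k).
Proof.
move=> cF.
have cU k : completion (\big[setU/set0]_(i < k) F i).
  elim: k => [|k IH].
    rewrite big_ord0; split; first exact: measurable0.
    by move=> xi _; rewrite integral_set0.
  rewrite big_ord_recr/= -[_ `|` _]setCK setCU.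
  by apply: completionC; apply: completionI; apply: completionC.
(* The integral of [xi] is additive over disjoint unions only, so [F] is replaced by the disjoint
   sequence [seqDU F]. *)
have cD k : completion (seqDU F k).
  by rewrite /seqDU setDE; apply: completionI => //; exact: completionC.
split; first by apply: bigcupT_measurable => k; exact: (cF k).1.
move=> xi oxi; rewrite seqDU_bigcup_eq integral_bigcup//.
- by rewrite eseries0// => k _ _; exact: (cD k).2.
- by move=> k; exact: (cD k).1.
- by apply: integrableS oxi.1 => //; apply: bigcupT_measurable => k; exact: (cD k).1.
Qed.

Lemma sigma_algebra_completion : sigma_algebra [set: Omega] completion.
Proof.
split.
- split; first exact: measurable0.
  by move=> xi _; rewrite integral_set0.
- by move=> E cE; rewrite setTD; exact: completionC.
- exact: completion_bigcup.
Qed.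

Lemma completion_negligible E : measurable E -> P E = 0%E -> completion E.
Proof.
move=> mE E0; split=> // xi [ixi _]; apply: null_set_integral => //.
exact: measurable_funTS (measurable_int _ ixi).
Qed.

(** The outcomes, with the completion as their sigma-algebra: the calculus of [measurable_fun] and
    the approximation by simple functions become available for the completion. *)
Definition completedType := g_sigma_algebraType completion.

Lemma measurable_completed (E : set completedType) :
  measurable E = completion E.
Proof. by rewrite /measurable/= sigma_algebra_id//; exact: sigma_algebra_completion. Qed.

Lemma meas_wrt_completed (f : Omega -> R) : meas_wrt G f ->
  measurable_fun setT (f : completedType -> R).
Proof.
move=> mf _ C mC; rewrite setTI measurable_completed.
exact/sub_completion/mf.
Qed.

Lemma completed_measurable (f : Omega -> R) :
  measurable_fun setT (f : completedType -> R) -> measurable_fun setT f.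
Proof.
move=> mf _ C mC; rewrite setTI.
have := mf measurableT C mC; rewrite setTI measurable_completed.
by case.
Qed.

End completion.

Section orthogonal_functions.
Context {d} {Omega : measurableType d} {R : realType}.
Variable P : probability Omega R.
Variable G : set (set Omega).
Hypothesis sG : sigma_algebra [set: Omega] G.
Hypothesis mG : G `<=` measurable.
Local Notation OG := (completedType P G).

Lemma integrable_boundedM (xi f : Omega -> R) K :
  P.-integrable setT (EFin \o xi) -> measurable_fun setT f ->
  (forall o, `|f o| <= K) ->
  P.-integrable setT (EFin \o (fun o => xi o * f o)).
Proof.
move=> ixi mf fK.
have bf : [bounded f o | o in [set: Omega]].
  exists K; split; first exact: num_real.
  by move=> M KM o _ /=; rewrite (le_trans (fK o))// ltW.
have := integrableMr measurableT mf bf ixi.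
by apply: eq_integrable => // o _ /=; rewrite mulrC EFinM.
Qed.

Lemma cvg_integral_dominatedM (xi : Omega -> R) (f_ : (Omega -> R)^nat) f K :
  P.-integrable setT (EFin \o xi) -> (forall k, measurable_fun setT (f_ k)) ->
  (forall k o, `|f_ k o| <= K) -> (forall o, f_ ^~ o @ \oo --> f o) ->
  (\int[P]_o (xi o * f_ k o)%:E @[k --> \oo] --> \int[P]_o (xi o * f o)%:E)%E.
Proof.
move=> ixi mf_ f_K f_f.
have mxi : measurable_fun setT xi by apply/measurable_EFinP; exact: measurable_int ixi.
have mf : measurable_fun setT f by exact: (measurable_fun_cvg mf_ (fun o _ => f_f o)).
have : P.-integrable setT (fun o => K%:E * `|(xi o)%:E|)%E.
  by apply: integrableZl => //; exact: integrable_abse.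
move=> iK.
have [] // := @dominated_convergence _ _ _ P setT measurableT
  (fun k o => (xi o * f_ k o)%:E) (fun o => (xi o * f o)%:E) (fun o => K%:E *
    `|(xi o)%:E|)%E.
- by move=> k; apply/measurable_EFinP; exact: measurable_funM.
- by apply/measurable_EFinP; exact: measurable_funM.
- apply: aeW => o _; apply: cvg_EFin; first exact: nearW.
  by apply: cvgMr; exact: f_f.
- apply: aeW => o k _.
  by rewrite abse_EFin normrM mulrC EFinM lee_pmul// lee_fin.
Qed.

Lemma integral_bounded_lim (xi : Omega -> R) (f_ : (Omega -> R)^nat) f K :
  P.-integrable setT (EFin \o xi) -> (forall k, measurable_fun setT (f_ k)) ->
  (forall k o, `|f_ k o| <= K) -> (forall o, f_ ^~ o @ \oo --> f o) ->
  (forall k, \int[P]_o (xi o * f_ k o)%:E = 0)%E ->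
  (\int[P]_o (xi o * f o)%:E = 0)%E.
Proof.
move=> ixi mf_ f_K f_f f_0.
have := cvg_integral_dominatedM ixi mf_ f_K f_f.
under eq_cvg do rewrite f_0.
by move=> /cvg_lim <- //; rewrite lim_cst.
Qed.

Import HBNNSimple.

(** [f] is a bounded increasing limit of simple functions whose level sets lie in the completion;
    over each level set the integral of [xi] vanishes by definition. *)
Let orthogonal_bounded_ge0 (xi f : Omega -> R) K :
  orthogonal_to P G xi -> measurable_fun setT (f : OG -> R) ->
  (forall o, 0 <= f o <= K) -> (\int[P]_o (xi o * f o)%:E = 0)%E.
Proof.
move=> oxi mf fK; have [ixi _] := oxi.
have mF : measurable_fun setT (EFin \o f : OG -> \bar R) by exact/measurable_EFinP.
pose g := nnsfun_approx measurableT mF.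
have f0 (x : OG) : [set: OG] x -> (0 <= (EFin \o f) x)%E.
  by move=> _; rewrite lee_fin; have /andP[] := fK x.
have gf o : (g ^~ o : nat -> R) @ \oo --> f o.
  by have := @cvg_nnsfun_approx _ _ _ _ measurableT _ mF f0 o I => /fine_cvgP[].
have g_le k o : g k o <= f o.
  rewrite -(cvg_lim (@Rhausdorff R) (gf o)).
  apply: nondecreasing_cvgn_le; last by apply/cvg_ex; exists (f o); exact: gf.
  by move=> a b ab; have /lefP := @nd_nnsfun_approx _ _ _ _ measurableT _ mF _ _ ab;
    exact.
have mg k : measurable_fun setT (g k : OG -> R) by [].
have mg' k : measurable_fun setT (g k : Omega -> R) by apply: completed_measurable;
  [exact: sG|exact: mG|exact: mg].
apply: (integral_bounded_lim (K := K) ixi mg' _ gf) => [k o|k].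
  by rewrite ger0_norm// (le_trans (g_le _ _))//; have /andP[] := fK o.
pose s : seq R := finmap.enum_fset (fset_set (range (g k))).
pose A (i : nat) := g k @^-1` [set s`_i].
have cA i : completion P G (A i).
  have := @measurable_funPTI _ _ _ _ (g k) _ (measurable_set1 s`_i).
  by rewrite measurable_completed.
transitivity (\int[P]_o \sum_(i < size s)
    (((s`_i)%R)%:E * (xi o * \1_(A i) o)%:E))%E.
  apply: eq_integral => o _; rewrite fimfunEord mulr_sumr -sumEFin.
  by apply: eq_bigr => i _; rewrite mulrCA.
have iA i : P.-integrable setT (EFin \o (fun o => xi o * \1_(A i) o)).
  by apply: integrable_indicM => //; exact: (cA i).1.
rewrite integral_sum//; last by move=> i; exact: (integrableZl _ _ (iA i)).
apply: big1 => i _; rewrite (integralZl _ (iA i))//.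
by rewrite -integral_indicE (cA i).2// mule0.
Qed.

Lemma orthogonal_bounded (xi f : Omega -> R) K :
  orthogonal_to P G xi -> measurable_fun setT (f : OG -> R) ->
  (forall o, `|f o| <= K) -> (\int[P]_o (xi o * f o)%:E = 0)%E.
Proof.
move=> oxi mf fK; have [ixi _] := oxi.
pose a (o : OG) := Num.max (f o) 0; pose b (o : OG) := Num.max (- f o) 0.
have ma : measurable_fun setT a by apply: measurable_maxr.
have mb : measurable_fun setT b by apply: measurable_maxr => //; exact: measurable_funN.
have K0 (o : Omega) : 0 <= K by exact: le_trans (fK o).
have a0 o : 0 <= a o <= K.
  by rewrite le_max lexx orbT ge_max (K0 o) andbT (le_trans (ler_norm _) (fK o)).
have b0 o : 0 <= b o <= K.
  by rewrite le_max lexx orbT ge_max (K0 o) andbT (le_trans (ler_norm _))// normrN fK.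
have ab o : f o = a o - b o.
  rewrite /a /b; case: (leP (f o) 0) => [fo|/ltW fo].
    by rewrite (max_idPl _) ?oppr_ge0// sub0r opprK.
  by rewrite (max_idPr _) ?oppr_le0// subr0.
have nK (c : Omega -> R) : (forall o, 0 <= c o <= K) -> forall o, `|c o| <= K.
  by move=> c0 o; have /andP[? ?] := c0 o; rewrite ger0_norm.
under eq_integral do rewrite ab mulrBr EFinB.
rewrite integralB_EFin//; last 2 first.
- by apply: (integrable_boundedM ixi _ (nK _ a0)); exact: completed_measurable ma.
- by apply: (integrable_boundedM ixi _ (nK _ b0)); exact: completed_measurable mb.
by rewrite (orthogonal_bounded_ge0 oxi ma a0) (orthogonal_bounded_ge0 oxi mb b0) sube0.
Qed.

End orthogonal_functions.

Section annihilated_functions.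
Context {d} {Omega : measurableType d} {R : realType}.
Variable P : probability Omega R.
Variable G : set (set Omega).
Hypothesis sG : sigma_algebra [set: Omega] G.
Hypothesis mG : G `<=` measurable.
Local Notation OG := (completedType P G).

(** A description of [L^oo] of the completion by integrals alone. Unlike measurability for [G], it
    can be checked by exchanging integrals. *)
Definition annihilated (f : Omega -> R) : Prop :=
  [/\ measurable_fun setT f, exists K, forall o, `|f o| <= K &
      forall xi, orthogonal_to P G xi -> (\int[P]_o (xi o * f o)%:E = 0)%E].

(** Once [xi * f] is itself a test function, a second annihilated [g] can be tested against it; this
    is why the annihilated functions are closed under products. *)
Lemma annihilated_orthogonal f xi : annihilated f -> orthogonal_to P G xi ->
  orthogonal_to P G (fun o => xi o * f o).
Proof.
move=> [mf [K fK] f0] oxi; split; first exact: integrable_boundedM oxi.1 mf fK.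
move=> E GE.
have cE := sub_completion P mG GE.
rewrite -[RHS](f0 _ (orthogonal_indicM sG mG oxi cE)) integral_indicE.
by apply: eq_integral => o _; rewrite mulrAC.
Qed.

Lemma annihilatedM f g : annihilated f -> annihilated g ->
  annihilated (fun o => f o * g o).
Proof.
move=> af ag; have [mf [K fK] f0] := af; have [mg [L gL] g0] := ag.
split; first exact: measurable_funM.
  by exists (K * L) => o; rewrite normrM ler_pM.
move=> xi oxi; rewrite -[RHS](g0 _ (annihilated_orthogonal af oxi)).
by apply: eq_integral => o _; rewrite mulrA.
Qed.

Lemma annihilatedD f g : annihilated f -> annihilated g ->
  annihilated (fun o => f o + g o).
Proof.
move=> [mf [K fK] f0] [mg [L gL] g0].
split; first exact: measurable_funD.
  by exists (K + L) => o; rewrite (le_trans (ler_normD _ _))// lerD.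
move=> xi oxi; have ixi := oxi.1.
under eq_integral do rewrite mulrDr EFinD.
rewrite integralD_EFin//; last 2 first.
- exact: integrable_boundedM ixi mf fK.
- exact: integrable_boundedM ixi mg gL.
by rewrite f0// g0// adde0.
Qed.

Lemma annihilated_cst c : annihilated (fun=> c).
Proof.
split => //; first by exists `|c|.
move=> xi oxi; apply: (orthogonal_bounded sG mG oxi (K := `|c|)) => //.
Qed.

Lemma annihilatedX f k : annihilated f -> annihilated (fun o => f o ^+ k).
Proof.
move=> af; elim: k => [|k IH].
  by under eq_fun do rewrite expr0; exact: annihilated_cst.
by under eq_fun do rewrite exprS; exact: annihilatedM.
Qed.

Lemma annihilated_lim (f_ : (Omega -> R)^nat) f K : (forall k, annihilated (f_ k)) ->
  (forall k o, `|f_ k o| <= K) -> (forall o, f_ ^~ o @ \oo --> f o) ->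
  annihilated f.
Proof.
move=> af f_K f_f.
have mf_ k : measurable_fun setT (f_ k) by have [] := af k.
split.
- exact: (measurable_fun_cvg mf_ (fun o _ => f_f o)).
- exists K => o.
  have cn : `|f_ k o| @[k --> \oo] --> `|f o| by apply: cvg_norm; exact: f_f.
  rewrite -(cvg_lim (@Rhausdorff R) cn); apply: limr_le; first exact: cvgP cn.
  by apply: nearW => k; exact: f_K.
move=> xi oxi; apply: (integral_bounded_lim oxi.1 mf_ f_K f_f) => k.
by have [_ _ ->] := af k.
Qed.

(** The partial sums of the exponential series are polynomials in [f], uniformly bounded by
    [expR K]. *)
Lemma annihilated_expR f : annihilated f -> annihilated (fun o => expR (f o)).
Proof.
move=> af; have [mf [K fK] _] := af.
have ser k : annihilated (fun o => series (exp_coeff (f o)) k).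
  elim: k => [|k IH].
    by under eq_fun do rewrite /series/= big_nil; exact: annihilated_cst.
  under eq_fun do rewrite seriesSr.
  apply: annihilatedD => //.
  under eq_fun do rewrite /exp_coeff.
  by apply: annihilatedM; [exact: annihilatedX|exact: annihilated_cst].
apply: (annihilated_lim (K := expR K) ser) => [k o|o];
  last exact: is_cvg_series_exp_coeff.
have K0 : 0 <= K by exact: le_trans (fK o).
apply: (@le_trans _ _ (series (exp_coeff K) k)).
  rewrite /series /= (le_trans (ler_norm_sum _ _ _))//; apply: ler_sum => i _.
  by rewrite /exp_coeff normrM normrX [`|_^-1|]ger0_norm// ler_wpM2r// lerXn2r.
apply: nondecreasing_cvgn_le; last exact: is_cvg_series_exp_coeff.
by apply: nondecreasing_series => i _ _; rewrite /exp_coeff /= divr_ge0// exprn_ge0.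
Qed.

(* With [v] affine in [f] such that [v > 0], and [v < 1] iff [f > c], the
   functions [expR (- v ^+ j)] tend to [1], [expR (- 1)] or [0] according to
   whether [f] is above, at or below the level [c]. *)
Lemma annihilated_gt f c : annihilated f -> completion P G (f @^-1` `]c, +oo[).
Proof.
move=> af; have [mf [K fK] _] := af.
(* [L] exceeds [|f - c|] everywhere, so that [v = 1 - (f - c) / L] is positive. *)
pose L := `|K| + `|c| + 1.
have L0 : 0 < L by rewrite ltr_wpDl// addr_ge0.
pose v o := 1 + (c / L + (- L^-1) * f o).
have vE o : v o = 1 - (f o - c) / L by rewrite /v; ring.
have v0 o : 0 < v o.
  rewrite vE subr_gt0 ltr_pdivrMr// mul1r.
  rewrite (le_lt_trans (ler_norm _))// (le_lt_trans (ler_normB _ _))//.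
  by rewrite /L ltr_pwDr// lerD2r (le_trans (fK o))// ler_norm.
have v_lt1 o : (v o < 1) = (c < f o).
  by rewrite vE gtrBl pmulr_lgt0 ?invr_gt0// subr_gt0.
have av : annihilated v.
  apply: annihilatedD; first exact: annihilated_cst.
  apply: annihilatedD; first exact: annihilated_cst.
  by apply: annihilatedM => //; exact: annihilated_cst.
pose phi j o := expR (- 1 * v o ^+ j).
have aphi j : annihilated (phi j).
  apply: annihilated_expR; apply: annihilatedM; first exact: annihilated_cst.
  exact: annihilatedX.
pose g o : R := if v o < 1 then 1 else if v o == 1 then expR (- 1) else 0.
have ag : annihilated g.
  apply: (annihilated_lim (K := 1) aphi) => [j o|o].
    rewrite /phi ger0_norm ?expR_ge0// -[leRHS]expR0 ler_expR mulN1r oppr_le0.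
    by rewrite exprn_ge0// ltW.
  rewrite /g /phi; case: ltgtP => [v1|v1|->].
  - have : (fun j => - 1 * v o ^+ j) @ \oo --> (0 : R).
      rewrite -(mulr0 (- 1)); apply: cvgMr; apply: cvg_expr.
      by rewrite ger0_norm// ltW.
    move=> h; rewrite -[X in _ --> X]expR0.
    exact: (cvg_comp _ _ h (@continuous_expR R 0)).
  (* Above 1, [expR (- v ^+ j)] is squeezed between 0 and [v ^- j], because
     [v ^+ j <= expR (v ^+ j)]. *)
  - have h : (v o)^-1 ^+ j @[j --> \oo] --> (0 : R).
      by apply: cvg_expr; rewrite ger0_norm ?invr_ge0 ?ltW// invf_lt1.
    apply: (squeeze_cvgr _ (cvg_cst 0) h); apply: nearW => j.
    rewrite expR_ge0/= mulN1r expRN exprVn lef_pV2 ?posrE ?expR_gt0 ?exprn_gt0//.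
    by rewrite (le_trans _ (expR_ge1Dx _))// lerDr.
  - by under eq_cvg do rewrite expr1n mulr1; exact: cvg_cst.
pose e1 : R := expR (- 1).
have e1lt : 1 - e1 != 0 by rewrite subr_eq0 gt_eqF// /e1 expR_lt1 oppr_lt0.
(* The polynomial [z (z - e1) / (1 - e1)] sends the three values 1, [e1] and 0 of [g] to 1, 0 and 0:
   its value at [g] is the indicator of [f > c]. *)
have aind : annihilated (fun o => (1 - e1)^-1 * (g o * g o + - e1 * g o)).
  apply: annihilatedM; first exact: annihilated_cst.
  apply: annihilatedD; first exact: annihilatedM.
  by apply: annihilatedM => //; exact: annihilated_cst.
split; first by rewrite -[X in measurable X]setTI; apply: mf.
move=> xi oxi; have [_ _ aind0] := aind.
rewrite -[RHS](aind0 _ oxi) integral_indicE; apply: eq_integral => o _.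
congr (EFin (_ * _)); rewrite indicE /g v_lt1.
have -> : (o \in f @^-1` `]c, +oo[) = (c < f o).
  by apply/idP/idP; rewrite inE /= in_itv/= andbT.
case: ifPn => _; first by rewrite mulr1 mulNr mulr1 mulVf.
case: ifPn => _; first by rewrite -/e1 mulNr subrr mulr0.
by rewrite mulr0 mulr0 addr0 mulr0.
Qed.

Lemma annihilated_completed f : annihilated f ->
  measurable_fun setT (f : OG -> R).
Proof.
move=> af; apply: (measurability _ (RGenOInfty.measurableE R)) => // _ [_ [c ->] <-].
by rewrite setTI measurable_completed//; exact: annihilated_gt.
Qed.

End annihilated_functions.

(** * Time integrals of adapted processes *)

Section time_integrals.
Context {d} {Omega : measurableType d} {R : realType}.
Variable P : probability Omega R.
Variable G : set (set Omega).
Hypothesis sG : sigma_algebra [set: Omega] G.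
Hypothesis mG : G `<=` measurable.
Local Notation OG := (completedType P G).
Local Notation mu := (@lebesgue_measure R).
Variable t : R.
Hypothesis t0 : 0 <= t.

Lemma measurable_swap_process (v : R -> Omega -> R) :
  measurable_fun (`[0, t] `*` [set: Omega]) (fun q : R * Omega => v q.1 q.2) ->
  measurable_fun ([set: Omega] `*` `[0, t]%classic) (fun z : Omega * R => v z.2 z.1).
Proof.
move=> mv.
have : measurable_fun ([set: Omega] `*` `[0, t]%classic)
      ((fun q : R * Omega => v q.1 q.2) \o (fun z : Omega * R => (z.2, z.1))).
    apply: (measurable_comp _ _ mv).
    + exact: measurableX.
    + by move=> _ [[w s] [_ st] <-]; split.
    + by apply: measurable_funTS; apply: measurable_fun_pair.
  by [].
Qed.

Lemma measurable_time_integral (v : R -> Omega -> R) :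
  measurable_fun (`[0, t] `*` [set: Omega]) (fun q : R * Omega => v q.1 q.2) ->
  measurable_fun setT (fun o => \int[mu]_(s in `[0, t]) v s o).
Proof.
move=> mv.
apply: (measurable_Rintegral_xsection mu (E := [set: Omega] `*` `[0, t]%classic)
  (f := fun z : Omega * R => v z.2 z.1)) => //.
- exact: measurableX.
- exact: measurable_swap_process.
- by move=> o s _; split=> [st|[_ st]] //; split.
Qed.

Lemma annihilated_time_integral (v : R -> Omega -> R) K :
  measurable_fun (`[0, t] `*` [set: Omega]) (fun q : R * Omega => v q.1 q.2) ->
  (forall s o, `|v s o| <= K) ->
  (forall s, s \in `[0, t] -> meas_wrt G (v s)) ->
  annihilated P G (fun o => \int[mu]_(s in `[0, t]) v s o).
Proof.
move=> mv vK aG.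
have mI : measurable (`[0, t]%classic : set R) by exact: measurable_itv.
have mut : mu `[0, t]%classic = t%:E.
  rewrite lebesgue_measure_itv/= lte_fin; move: t0; rewrite le_eqVlt => /predU1P[<-|->].
    by rewrite ltxx.
  by rewrite oppr0 adde0.
have muty : (mu `[0%R, t]%classic < +oo)%E by rewrite mut ltry.
have mvo o : measurable_fun `[0, t] (v^~ o).
  have : measurable_fun `[0, t] ((fun q : R * Omega => v q.1 q.2) \o (fun s => (s, o))).
    apply: (measurable_comp _ _ mv).
    + exact: measurableX.
    + by move=> _ [s st <-]; split.
    + by apply: measurable_funTS; exact: pair2_measurable.
  by [].
have ivo o : mu.-integrable `[0, t] (fun s => (v s o)%:E).
  apply: measurable_bounded_integrable => //; first exact: mvo.
  exists K; split; first exact: num_real.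
  by move=> M KM s _ /=; rewrite (le_trans (vK _ _))// ltW.
split.
- exact: measurable_time_integral.
- exists (K * t) => o; apply: (le_trans (@le_normr_Rintegral _ _ _ mu _ _
  (measurable_itv _) (ivo o))).
  apply: (@le_trans _ _ (\int[mu]_(s in `[0, t]) K)).
    apply: le_Rintegral => //.
    + by have := integrable_norm (ivo o).
    + by apply: continuous_compact_integrable; [exact: segment_compact|move=> ?;
      exact: cvg_cst].
  have Kt : K * fine (mu `[0%R, t]%classic) <= K * t by rewrite mut.
  by rewrite Rintegral_cst.
move=> xi oxi; have [ixi _] := oxi.
(* The process is set to 0 outside [[0, t]], so that Fubini's theorem is used on the whole product;
   the hypothesis on [v] concerns times in [[0, t]] only. *)
pose w (z : Omega * R) : R := v z.2 z.1 * \1_(`[0, t]%classic) z.2.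
have mw : measurable_fun setT w.
  rewrite (_ : w = (fun z => v z.2 z.1) \_ ([set: Omega] `*` `[0, t]%classic));
    last first.
    apply/funext => z; rewrite /w patchE indicE.
    have -> : (z \in [set: Omega] `*` `[0, t]%classic) = (z.2 \in `[0, t]%classic).
      by apply/idP/idP; rewrite !inE; [case|split].
    by case: (_ \in _); rewrite ?mulr1 ?mulr0.
  apply/(measurable_restrictT _ _).1; last exact: (measurable_swap_process mv).
  exact: measurableX.
pose h z := xi z.1 * w z.
have wK o s : `|w (o, s)| <= K * \1_(`[0, t]%classic) s.
  by rewrite /w /= normrM [X in _ * X]ger0_norm// ler_wpM2r.
have mxi : measurable_fun setT xi by apply/measurable_EFinP; exact: measurable_int ixi.
have mh : measurable_fun setT h.
  by apply: measurable_funM => //; exact: measurableT_comp.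
have mhn : measurable_fun setT (fun z => `|(h z)%:E|%E).
  by apply: measurableT_comp => //; exact/measurable_EFinP.
have hn0 z : (0 <= `|(h z)%:E|)%E by [].
have ih : (P \x mu)%E.-integrable setT (EFin \o h).
  apply/integrable12ltyP; first exact/measurable_EFinP.
  apply: (@le_lt_trans _ _ (\int[P]_o (`|(xi o)%:E| * (K * t)%:E)))%E; last first.
    have ixn := integrable_abse ixi.
    have := integrable_lty measurableT (integrableZr measurableT (K * t) ixn).
    by []. 
  apply: ge0_le_integral => //.
  - by move=> o _; exact: integral_ge0.
  - exact: (measurable_fun_fubini_tonelli_F (m2 := mu) _ mhn hn0).
  - by apply: emeasurable_funM => //; apply: measurableT_comp => //;
    exact/measurable_EFinP.
  move=> o _.
  have K0 : 0 <= K by exact: le_trans (normr_ge0 _) (vK 0 o).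
  apply: (@le_trans _ _ (\int[mu]_s (`|xi o| * (K * \1_(`[0, t]%classic) s))%:E)%E).
    apply: ge0_le_integral => //.
    - apply: (measurableT_comp mhn); exact: pair1_measurable.
    - by apply/measurable_EFinP; do 2 apply: measurable_funM => //;
      exact: measurable_indic.
    - by move=> s _; rewrite /= lee_fin normrM ler_wpM2l.
  have iK : mu.-integrable setT (EFin \o (fun s => K * \1_(`[0, t]%classic) s)).
    have := @integrableZl _ _ _ mu _ measurableT K _ (integrable_indic_itv (0 :
      R) t true false).
    by apply: eq_integrable => // s _.
  under eq_integral do rewrite EFinM.
  rewrite integralZl// abse_EFin.
  rewrite lee_pmul// ?integral_ge0// => [s _|].
    by rewrite lee_fin mulr_ge0.
  under eq_integral do rewrite EFinM.
  rewrite integralZl//; last exact: (integrable_indic_itv (0 : R) t true false).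
  rewrite integral_indic// setIT.
  by rewrite [X in (_ * X)%E]mut EFinM.
transitivity (\int[P]_o \int[mu]_s (EFin \o h) (o, s))%E.
  apply: eq_integral => o _; rewrite /Rintegral EFinM fineK; last first.
    by apply: integrable_fin_num => //; exact: ivo.
  rewrite -(@integralZl _ _ _ mu _ mI _ (ivo o)).
  rewrite integral_mkcond; apply: eq_integral => s _.
  rewrite patchE /h /w /= indicE; case: ifPn => _; last by rewrite !mulr0.
  by rewrite mulr1 EFinM.
rewrite (Fubini ih); apply: integral0_eq => s _.
rewrite /h /w /=; have [st|st] := boolP (s \in `[0, t]%classic).
  under eq_integral do rewrite indicE st mulr1.
  apply: (orthogonal_bounded sG mG oxi (K := K)) => //.
  by apply: meas_wrt_completed => //; apply: aG; move: st; rewrite inE.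
under eq_integral do rewrite indicE (negbTE st) mulr0 mulr0.
exact: integral0.
Qed.

(* The processes are only adapted and jointly measurable and [G] contains no
   null sets, so the time integral need not be measurable for [G] itself. *)
Lemma completed_time_integral (v : R -> Omega -> R) :
  measurable_fun (`[0, t] `*` [set: Omega]) (fun q : R * Omega => v q.1 q.2) ->
  {ae P, forall o, mu.-integrable `[0, t] (fun s => (v s o)%:E)} ->
  (forall s, s \in `[0, t] -> meas_wrt G (v s)) ->
  measurable_fun setT ((fun o => \int[mu]_(s in `[0, t]) v s o) : OG -> R).
Proof.
move=> mv [N [mN N0 iN]] aG.
(* Values outside [[- k, k]] are replaced by 0. Thus [tr k x] is bounded by [k], dominated by [|x|],
   and equal to [x] for large [k]. *)
pose tr (k : nat) (x : R) := x * \1_(`[- k%:R, k%:R]%classic) x.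
have mtr k : measurable_fun setT (tr k) by apply: measurable_funM => //;
  exact: measurable_indic.
pose V k o := \int[mu]_(s in `[0, t]) tr k (v s o).
have mV k : measurable_fun setT (V k : OG -> R).
  apply: annihilated_completed => //; apply: (annihilated_time_integral (K := k%:R)).
  - exact: measurableT_comp mv.
  - move=> s o; rewrite /tr indicE; have [|_] := boolP (_ \in _).
      by rewrite inE /= in_itv/= mulr1 ler_norml.
    by rewrite mulr0 normr0.
  - move=> s st C mC; rewrite (_ : _ @^-1` C = v s @^-1` (tr k @^-1` C))//.
    by apply: aG => //; rewrite -[X in measurable X]setTI; exact: mtr.
have cN : completion P G (~` N).
  by apply: completionC => //; exact: completion_negligible.
have mOGN : measurable (~` N : set OG) by rewrite measurable_completed.
have VN : measurable_fun (~` N : set OG) ((fun o => \int[mu]_(s in `[0,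
  t]) v s o) : OG -> R).
  apply: (@measurable_fun_cvg _ OG R _ V) => [k|o No]; first exact: measurable_funTS.
  have ivo : mu.-integrable `[0, t] (fun s => (v s o)%:E).
    by apply: contrapT => nint; apply: No; exact: iN.
  have mvo : measurable_fun `[0, t] (v^~ o) by apply/measurable_EFinP;
    exact: measurable_int ivo.
  have tr_cvg : {ae mu, forall s, `[0, t]%classic s ->
      (tr k (v s o))%:E @[k --> \oo] --> (v s o)%:E}.
    apply: aeW => s _; apply: cvg_near_cst; near=> k.
    congr EFin; rewrite /tr indicE mem_set ?mulr1//=.
    by rewrite in_itv/= -ler_norml; near: k; exact: nbhs_infty_ger.
  have tr_le : {ae mu, forall s k, `[0, t]%classic s ->
      (`|(tr k (v s o))%:E| <= `|(v s o)%:E|)%E}.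
    apply: aeW => s k _; rewrite !abse_EFin lee_fin /tr normrM.
    by rewrite ler_piMr// indicE; case: (_ \in _); rewrite /= ?normr1 ?normr0.
  have mtrv k : measurable_fun `[0, t] (fun s => (tr k (v s o))%:E).
    by apply/measurable_EFinP; exact: measurableT_comp.
  have [_ _ h] := @dominated_convergence _ _ _ mu `[0, t]%classic (measurable_itv _)
    (fun k s => (tr k (v s o))%:E) (fun s => (v s o)%:E) (fun s => `|(v s o)%:E|)%E
    mtrv (measurable_int _ ivo) tr_cvg (integrable_abse ivo) tr_le.
  apply: fine_cvg; rewrite fineK//.
  exact: integrable_fin_num.
move=> _ C mC; rewrite setTI measurable_completed//.
(* Outside [N] the integral is the limit of the [V k]. Inside [N] its preimages are null, but
   [completion] contains only measurable sets, hence the appeal to measurability on [Omega]. *)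
have mW := measurable_time_integral mv.
set W := fun o => _.
have -> : W @^-1` C = (~` N `&` W @^-1` C) `|` (N `&` W @^-1` C).
  by rewrite -setIUl setUC setUv setTI.
have [c0 cC cU] := sigma_algebra_completion P sG mG.
rewrite -bigcup2E; apply: cU => -[|[|k]] /=.
- by have := VN mOGN C mC; rewrite measurable_completed.
- have mNW : measurable (N `&` W @^-1` C).
    by apply: measurableI => //; rewrite -[X in measurable X]setTI; exact: mW.
  apply: completion_negligible => //; apply/eqP; rewrite -measure_le0.
  by rewrite -N0 le_measure ?inE.
- exact: c0.
Unshelve. all: by end_near. Qed.

End time_integrals.

(** * Conditional expectation of sums with unbounded coefficients *)

Section conditional_expectation_of_sums.
Context {d} {Omega : measurableType d} {R : realType}.
Variable P : probability Omega R.
Variable G : set (set Omega).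
Hypothesis sG : sigma_algebra [set: Omega] G.
Hypothesis mG : G `<=` measurable.
Local Notation OG := (completedType P G).

Lemma cond_exp_orthogonal (Z Y : Omega -> R) : cond_exp P G Z Y ->
  orthogonal_to P G (fun o => Y o - Z o).
Proof.
move=> [iZ iY _ YZ]; split; first exact: (integrableB measurableT iY iZ).
move=> E GE; have mE := mG GE.
have iYE : P.-integrable E (EFin \o Y) by exact: integrableS iY.
have iZE : P.-integrable E (EFin \o Z) by exact: integrableS iZ.
under eq_integral do rewrite EFinB.
rewrite integralB_EFin// YZ// subee//.
exact: integrable_fin_num.
Qed.

Variables (I : finType) (zeta M a : I -> Omega -> R).
Hypothesis condM : forall i, cond_exp P G (zeta i) (M i).
Hypothesis ma : forall i, measurable_fun setT (a i : OG -> R).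

Let Z o := \sum_i a i o * zeta i o.
Let Y o := \sum_i a i o * M i o.

Hypothesis iZ : P.-integrable setT (EFin \o Z).

(* Only the sum [Z] is known to be integrable, not its terms: the conditioning is
   done term by term on [D k], where the coefficients are bounded by [k]. *)
Let D (k : nat) : set Omega := [set o | forall i, `|a i o| <= k%:R].

Let mM i : measurable_fun setT (M i : OG -> R).
Proof. by apply: meas_wrt_completed => //; have [] := condM i. Qed.

Let mY : measurable_fun setT (Y : OG -> R).
Proof. by apply: measurable_sum => i; apply: measurable_funM. Qed.

Let mYO : measurable_fun setT Y.
Proof. by apply: completed_measurable mY. Qed.

Let cD k : completion P G (D k).
Proof.
rewrite -measurable_completed//.
rewrite (_ : D k = \bigcap_(i in [set: I]) [set o : OG | `|a i o| <= k%:R]); last first.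
  by apply/seteqP; split=> o; [move=> Do i _; exact: Do|move=> Do i; exact: Do].
apply: fin_bigcap_measurable => // i _.
rewrite (_ : [set _ | _] = (fun o => `|a i o|) @^-1` `]-oo, k%:R]); last first.
  by apply/seteqP; split=> o /=; rewrite in_itv.
by rewrite -[X in measurable X]setTI; apply: (measurableT_comp _ (ma i)).
Qed.

(** On [E] the coefficients are bounded, so each [M i - zeta i] can be tested against [a i * \1_E].
    The set [E] is left free inside [D k] because the [L^1] bound also restricts to a sign of
    [Y]. *)
Let bound k E : completion P G E -> E `<=` D k ->
  P.-integrable setT (EFin \o (fun o => Y o * \1_E o)) /\
  (\int[P]_o (Y o * \1_E o)%:E = \int[P]_o (Z o * \1_E o)%:E)%E.
Proof.
move=> cE ED; have mE := cE.1.
have mEO : measurable (E : set OG) by rewrite measurable_completed.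
pose b i o := a i o * \1_E o.
have mb i : measurable_fun setT (b i : OG -> R).
  by apply: measurable_funM => //; exact: measurable_indic.
have bk i o : `|b i o| <= k%:R.
  rewrite /b indicE; have [|_] := boolP (o \in E); last by rewrite mulr0 normr0.
  by rewrite inE mulr1 => /ED.
have iM i : P.-integrable setT (EFin \o (fun o => M i o * b i o)).
  by apply: integrable_boundedM (bk i);
    [have [] := condM i|exact: completed_measurable (mb i)].
have iz i : P.-integrable setT (EFin \o (fun o => zeta i o * b i o)).
  by apply: integrable_boundedM (bk i);
    [have [] := condM i|exact: completed_measurable (mb i)].
have YE o : (Y o * \1_E o)%:E = (\sum_i (M i o * b i o)%:E)%E.
  by rewrite sumEFin /Y mulr_suml; congr EFin; apply: eq_bigr => i _; rewrite /b; ring.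
have ZE o : (Z o * \1_E o)%:E = (\sum_i (zeta i o * b i o)%:E)%E.
  by rewrite sumEFin /Z mulr_suml; congr EFin; apply: eq_bigr => i _; rewrite /b; ring.
split.
  have : P.-integrable setT (fun o => \sum_i (M i o * b i o)%:E)%E.
    by apply: (integrable_sum measurableT) => i _; exact: iM.
  by apply: eq_integrable => // o _; rewrite -YE.
under eq_integral do rewrite YE.
under [RHS]eq_integral do rewrite ZE.
rewrite (integral_sum measurableT iM) (integral_sum measurableT iz);
  apply: eq_bigr => i _.
have : (\int[P]_o ((M i o * b i o)%:E - (zeta i o * b i o)%:E) = 0)%E.
  rewrite -[RHS](orthogonal_bounded sG mG (cond_exp_orthogonal (condM i)) (mb i) (bk i)).
  by apply: eq_integral => o _; rewrite -EFinB mulrBl.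
rewrite integralB_EFin//.
have /fineK <- : (\int[P]_o (M i o * b i o)%:E)%E \is a fin_num
  by exact: integrable_fin_num (iM i).
have /fineK <- : (\int[P]_o (zeta i o * b i o)%:E)%E \is a fin_num
  by exact: integrable_fin_num (iz i).
by rewrite -EFinB => -[] /eqP; rewrite subr_eq0 => /eqP ->.
Qed.

Let cvgD o : \1_(D k) o @[k --> \oo] --> (1 : R).
Proof.
apply: cvg_near_cst; near=> k.
rewrite indicE mem_set// => i.
apply: (@le_trans _ _ (\sum_i `|a i o|)); last by near: k; exact: nbhs_infty_ger.
by rewrite (bigD1 i)//= lerDl sumr_ge0.
Unshelve. all: by end_near. Qed.

(** The contraction property of conditional expectations, by testing with the sign of [Y]: the parts
    of [D k] where [Y >= 0] and where [Y < 0] lie in the completion, so [Y] can be exchanged for [Z]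
    on each. Monotone convergence in [k] does not presuppose that [Y] is integrable. *)
Let le_abs : (\int[P]_o `|(Y o)%:E| <= \int[P]_o `|(Z o)%:E|)%E.
Proof.
have nd o m k : (m <= k)%N -> D m o -> D k o.
  by move=> mk Dm i; rewrite (le_trans (Dm i))// ler_nat.
pose g k o := (`|Y o| * \1_(D k) o)%:E.
have mg k : measurable_fun setT (g k).
  apply/measurable_EFinP; apply: measurable_funM; first exact: measurableT_comp.
  exact: measurable_indic (cD k).1.
have g0 k o : [set: Omega] o -> (0 <= g k o)%E by move=> _; rewrite lee_fin mulr_ge0.
have ndg o : [set: Omega] o -> {homo g ^~ o : m k / (m <= k)%N >-> (m <= k)%E}.
  move=> _ m k mk; rewrite lee_fin ler_wpM2l// !indicE.
  have [|_] := boolP (o \in D m); last by rewrite ler0n.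
  by rewrite inE => /(nd _ _ _ mk) Dk; rewrite mem_set.
have gY o : g ^~ o @ \oo --> `|(Y o)%:E|%E.
  apply: cvg_EFin; first exact: nearW.
  by rewrite -[X in _ --> X]mulr1; apply: cvgMr; exact: cvgD.
have := @cvg_monotone_convergence _ _ _ P setT measurableT g mg g0 ndg.
rewrite (eq_integral (fun o => `|(Y o)%:E|%E)); last first.
  by move=> o _; apply: cvg_lim => //; exact: gY.
move=> cg; rewrite -(cvg_lim _ cg)//.
apply: lime_le; first exact: cvgP cg.
apply: nearW => k.
pose E1 := D k `&` Y @^-1` `[0, +oo[; pose E2 := D k `&` Y @^-1` `]-oo, 0[.
have cYC C : measurable C -> completion P G (Y @^-1` C).
  by move=> mC; have := mY measurableT mC; rewrite setTI measurable_completed.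
have cE1 : completion P G E1 by apply: completionI => //; exact: cYC.
have cE2 : completion P G E2 by apply: completionI => //; exact: cYC.
have [iY1 YZ1] := bound cE1 (@subIsetl _ _ _).
have [iY2 YZ2] := bound cE2 (@subIsetl _ _ _).
have iZ1 := integrable_indicM cE1.1 iZ.
have iZ2 := integrable_indicM cE2.1 iZ.
have E1E o : \1_E1 o = \1_(D k) o * (0 <= Y o)%R%:R :> R.
  rewrite indicI /=; congr (_ * _); rewrite indicE; congr (_%:R).
  by congr nat_of_bool; apply/idP/idP; rewrite inE /= in_itv/= andbT.
have E2E o : \1_E2 o = \1_(D k) o * (Y o < 0)%R%:R :> R.
  rewrite indicI /=; congr (_ * _); rewrite indicE; congr (_%:R).
  by congr nat_of_bool; apply/idP/idP; rewrite inE /= in_itv/=.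
have -> : (\int[P]_o g k o = \int[P]_o ((Y o * \1_E1 o)%:E - (Y o * \1_E2 o)%:E))%E.
  apply: eq_integral => o _; rewrite -EFinB /g E1E E2E; congr EFin.
  case: (ltP (Y o) 0) => [Y0|Y0].
    by rewrite ltr0_norm//= mulr0 mulr0 mulr1; ring.
  by rewrite ger0_norm//= mulr1 !mulr0 subr0.
rewrite integralB_EFin// YZ1 YZ2 -integralB_EFin//.
apply: le_integral => //.
- exact: integrableB.
- exact: integrable_abse.
move=> o _; rewrite -EFinB lee_fin E1E E2E -mulrBr -mulrBr.
rewrite (le_trans (ler_norm _))// normrM ler_piMr// indicE.
case: (ltP (Y o) 0) => Y0; case: (_ \in _) => /=;
  rewrite ?mul0r ?mul1r ?normr0 ?subr0 ?sub0r ?normrN ?normr1//.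
Qed.

Lemma integrable_cond_exp_sum : P.-integrable setT (EFin \o Y).
Proof.
apply/integrableP; split; first exact/measurable_EFinP.
by apply: (le_lt_trans le_abs); have /integrableP[] := iZ.
Qed.

Lemma le_integral_cond_exp_sum :
  (\int[P]_o `|(\sum_i a i o * M i o)%:E| <=
   \int[P]_o `|(\sum_i a i o * zeta i o)%:E|)%E.
Proof. exact: le_abs. Qed.

(** [bound] with [E = D k], then dominated convergence in [k] on both sides; on the left it rests on
    the integrability of [Y] just obtained. *)
Lemma integral_cond_exp_sum :
  (\int[P]_o (\sum_i a i o * M i o)%:E = \int[P]_o (\sum_i a i o * zeta i o)%:E)%E.
Proof.
have mD k : measurable_fun setT (\1_(D k) : Omega -> R)
  by exact: measurable_indic (cD k).1.
have D1 k o : `|\1_(D k) o : R| <= 1.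
  by rewrite indicE; case: (_ \in _); rewrite /= ?normr1 ?normr0.
have cY := cvg_integral_dominatedM integrable_cond_exp_sum mD D1 cvgD.
have cZ := cvg_integral_dominatedM iZ mD D1 cvgD.
move: cY cZ; under eq_cvg do rewrite (bound (cD _) (@subset_refl _ _)).2.
move=> cY cZ.
have := cvg_unique _ cY cZ.
under eq_integral do rewrite mulr1.
by under [RHS]eq_integral do rewrite mulr1; apply.
Qed.

End conditional_expectation_of_sums.

(** * Interchange of expectation and time integral *)

Section fubini_on_a_time_interval.
Context {d} {Omega : measurableType d} {R : realType}.
Variable P : probability Omega R.
Local Notation mu := (@lebesgue_measure R).
Variable T : R.
Local Notation D := (`[0%R, T]%classic `*` [set: Omega]).

Let mD : measurable D. Proof. exact: measurableX. Qed.

Let restrictE (f : R * Omega -> R) t o :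
  (f \_ D) (t, o) = if t \in `[0, T]%classic then f (t, o) else 0.
Proof.
by rewrite patchE; congr (if _ then _ else _); apply/idP/idP; rewrite !inE; [case|split].
Qed.

Let integrable_restrictD (f : R * Omega -> R) :
  (mu \x P)%E.-integrable D (EFin \o f) ->
  (mu \x P)%E.-integrable setT (EFin \o (f \_ D)).
Proof.
by move=> intf; rewrite -restrict_EFin; apply/integrable_restrict => //=; rewrite setTI.
Qed.

(** The left-hand side loses infinite values through [fine], so the identity is claimed along
    integrable paths, which are almost all paths. *)
Let Rintegral_timeE (f : R * Omega -> R) :
  (mu \x P)%E.-integrable D (EFin \o f) ->
  {ae P, forall o, ((\int[mu]_(t in `[0%R, T]) f (t, o))%R%:E =
    \int[mu]_t (EFin \o (f \_ D)) (t, o))%E}.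
Proof.
move=> intf; have /ae_integrable2 := integrable_restrictD intf.
apply: filterS => o io; rewrite /Rintegral.
have E : (\int[mu]_(t in `[0%R, T]) (f (t, o))%:E =
    \int[mu]_t (EFin \o (f \_ D)) (t, o))%E.
  rewrite integral_mkcond; apply: eq_integral => t _.
  by rewrite /= restrictE patchE; case: ifP.
by rewrite -E fineK// E; exact: integrable_fin_num.
Qed.

Lemma ae_integrable_time (f : R * Omega -> R) :
  (mu \x P)%E.-integrable D (EFin \o f) ->
  {ae P, forall o, mu.-integrable `[0, T] (fun t => (f (t, o))%:E)}.
Proof.
move=> intf; have /ae_integrable2 := integrable_restrictD intf.
apply: filterS => o io.
apply/(@integrable_mkcond _ _ _ mu _ _ (measurable_itv _)).
apply: eq_integrable io => // t _.
by rewrite /= restrictE patchE; case: ifP.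
Qed.

Lemma integrable_time_integral (f : R * Omega -> R) :
  (mu \x P)%E.-integrable D (EFin \o f) ->
  P.-integrable setT (fun o => (\int[mu]_(t in `[0, T]) f (t, o))%R%:E).
Proof.
move=> intf; have ifr := integrable_restrictD intf.
have mfr : measurable_fun setT (f \_ D) by apply/measurable_EFinP;
  exact: measurable_int ifr.
have RE o : \int[mu]_(t in `[0, T]) f (t, o) = \int[mu]_t (f \_ D) (t, o).
  rewrite Rintegral_mkcond; apply: eq_Rintegral => t _.
  by rewrite restrictE patchE.
apply/integrableP; split.
  apply/measurable_EFinP; under eq_fun do rewrite RE.
  apply: (measurable_Rintegral_param mu (f := fun z : Omega * R => (f \_ D) (z.2, z.1))).
  by apply: (measurableT_comp mfr); exact: measurable_fun_pair.
have mabs : measurable_fun setT (abse \o (EFin \o (f \_ D))).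
  by apply: measurableT_comp => //; exact/measurable_EFinP.
have lty := (@integrable21ltyP _ _ _ _ R mu P _ (measurable_int _ ifr)).1 ifr.
apply: le_lt_trans lty.
apply: ge0_le_integral => //.
- apply: measurableT_comp => //; apply/measurable_EFinP; under eq_fun do rewrite RE.
  apply: (measurable_Rintegral_param mu (f := fun z : Omega * R => (f \_ D) (z.2, z.1))).
  by apply: (measurableT_comp mfr); exact: measurable_fun_pair.
- exact: (measurable_fun_fubini_tonelli_G (m1 := mu) _ mabs (fun=> abse_ge0 _)).
move=> o _; rewrite RE.
have mo : measurable_fun setT (fun t : R => (EFin \o (f \_ D)) (t, o)).
  by apply: measurableT_comp; [exact/measurable_EFinP|exact: pair2_measurable].
(* Sending infinite values to 0, [fine] does not increase absolute values. *)
apply: (@le_trans _ _ (`|\int[mu]_t (EFin \o (f \_ D)) (t, o)|)%E).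
  rewrite /Rintegral /=; case: (\int[mu]_t _)%E => [r| |] //=.
  - by rewrite normr0 leey.
  - by rewrite normr0 leey.
exact: le_abse_integral.
Qed.

Let integral_timeE (f : R * Omega -> R) :
  (mu \x P)%E.-integrable D (EFin \o f) ->
  (\int[P]_o (\int[mu]_(t in `[0, T]) f (t, o))%R%:E =
   \int[mu]_t \int[P]_o (EFin \o (f \_ D)) (t, o))%E.
Proof.
move=> intf; rewrite (ae_eq_integral_nonmeasurable (Rintegral_timeE intf)).
by rewrite -(Fubini (integrable_restrictD intf)).
Qed.

(** The comparison is asked only at times where [f (t, _)] is integrable, which are almost all
    times. Its [L^1] half carries integrability on the product from [f] over to [g]; its other half
    is then integrated over time. *)
Lemma eq_integral_time_integral (f g : R * Omega -> R) :
  (mu \x P)%E.-integrable D (EFin \o f) -> measurable_fun D g ->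
  (forall t, t \in `[0, T] -> P.-integrable setT (fun o => (f (t, o))%:E) ->
    (\int[P]_o (g (t, o))%:E = \int[P]_o (f (t, o))%:E)%E /\
    (\int[P]_o `|(g (t, o))%:E| <= \int[P]_o `|(f (t, o))%:E|)%E) ->
  (\int[P]_o (\int[mu]_(t in `[0, T]) g (t, o))%R%:E =
   \int[P]_o (\int[mu]_(t in `[0, T]) f (t, o))%R%:E)%E.
Proof.
move=> intf mg fg; have ifr := integrable_restrictD intf.
have aefg : {ae mu, forall t,
    (\int[P]_o (EFin \o (g \_ D)) (t, o) = \int[P]_o (EFin \o (f \_ D)) (t, o))%E /\
    (\int[P]_o `|(EFin \o (g \_ D)) (t, o)| <= \int[P]_o `|(EFin \o (f \_ D)) (t, o)|)%E}.
  have := ae_integrable1 ifr; apply: filterS => t it.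
  have [tT|tT] := boolP (t \in `[0, T]%classic).
    have itf : P.-integrable setT (fun o => (f (t, o))%:E).
      by apply: eq_integrable it => // o _; rewrite /= restrictE tT.
    have [E L] := fg t (set_mem tT) itf.
    split.
      under eq_integral do rewrite /= restrictE tT.
      by under [RHS]eq_integral do rewrite /= restrictE tT.
    under eq_integral do rewrite /= restrictE tT.
    by under [leRHS]eq_integral do rewrite /= restrictE tT.
  split.
    under eq_integral do rewrite /= restrictE (negbTE tT).
    by under [RHS]eq_integral do rewrite /= restrictE (negbTE tT).
  under eq_integral do rewrite /= restrictE (negbTE tT).
  by under [leRHS]eq_integral do rewrite /= restrictE (negbTE tT).
have mgr : measurable_fun setT (g \_ D) by apply/(measurable_restrictT _ _).1.
have mfr := measurable_int _ ifr.
have igr : (mu \x P)%E.-integrable setT (EFin \o (g \_ D)).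
  apply/integrable12ltyP; first exact/measurable_EFinP.
  apply: (@le_lt_trans _ _ (\int[mu]_t \int[P]_o `|(EFin \o (f \_ D)) (t, o)|)%E);
    last first.
    by apply/integrable12ltyP.
  have mabs (h : R * Omega -> R) : measurable_fun setT (EFin \o h) ->
      measurable_fun setT (fun t : R => \int[P]_o `|(EFin \o h) (t, o)|)%E.
    move=> mh; have mh' : measurable_fun setT (abse \o (EFin \o h))
      by exact: measurableT_comp.
    exact: (measurable_fun_fubini_tonelli_F (m2 := P) _ mh' (fun=> abse_ge0 _)).
  apply: ae_ge0_le_integral => //.
  - by move=> t _; exact: integral_ge0.
  - by apply: mabs; exact/measurable_EFinP.
  - by move=> t _; exact: integral_ge0.
  - exact: mabs.
  - by apply: (@filterS _ _ (ae_filter_ringOfSetsType mu) _ _ _ aefg) => t [].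
have ig : (mu \x P)%E.-integrable D (EFin \o g).
  apply/(@integrable_mkcond _ _ _ (mu \x P)%E D (EFin \o g) mD).
  by rewrite restrict_EFin.
rewrite (integral_timeE ig) (integral_timeE intf); apply: ae_eq_integral => //.
- exact: (measurable_fubini_F igr).
- exact: (measurable_fubini_F ifr).
by apply: (@filterS _ _ (ae_filter_ringOfSetsType mu) _ _ _ aefg) => t [].
Qed.

End fubini_on_a_time_interval.

(** * Measurability of the controlled processes *)

Section measurable_matrix_functions.
Context {d} {U : measurableType d} {R : realType}.
Variable D : set U.

Lemma measurable_mulmx k l (M : U -> 'M[R]_(k, l)) (v : U -> 'cV[R]_l) :
  (forall i j, measurable_fun D (fun q => M q i j)) ->
  (forall j, measurable_fun D (fun q => v q j 0)) ->
  forall i, measurable_fun D (fun q => (M q *m v q) i 0).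
Proof.
move=> mM mv i; under eq_fun do rewrite mxE.
by apply: measurable_sum => j; exact: measurable_funM.
Qed.

Lemma measurable_cmulmx k l (M : 'M[R]_(k, l)) (v : U -> 'cV[R]_l) :
  (forall j, measurable_fun D (fun q => v q j 0)) ->
  forall i, measurable_fun D (fun q => (M *m v q) i 0).
Proof. by move=> mv; apply: measurable_mulmx. Qed.

Lemma measurable_addmx k (v w : U -> 'cV[R]_k) :
  (forall j, measurable_fun D (fun q => v q j 0)) ->
  (forall j, measurable_fun D (fun q => w q j 0)) ->
  forall j, measurable_fun D (fun q => (v q + w q) j 0).
Proof.
by move=> mv mw j; under eq_fun do rewrite mxE; exact: measurable_funD.
Qed.

Lemma measurable_oppmx k (v : U -> 'cV[R]_k) :
  (forall j, measurable_fun D (fun q => v q j 0)) ->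
  forall j, measurable_fun D (fun q => (- v q) j 0).
Proof. by move=> mv j; under eq_fun do rewrite mxE; exact: measurable_funN. Qed.

Lemma measurable_dot k (v w : U -> 'cV[R]_k) :
  (forall j, measurable_fun D (fun q => v q j 0)) ->
  (forall j, measurable_fun D (fun q => w q j 0)) ->
  measurable_fun D (fun q => dot (v q) (w q)).
Proof.
move=> mv mw; under eq_fun do rewrite dotE.
by apply: measurable_sum => j; exact: measurable_funM.
Qed.

End measurable_matrix_functions.

Section controls.
Context {d} {Omega : measurableType d} {R : realType}.
Variable P : probability Omega R.
Local Notation mu := (@lebesgue_measure R).
Variable T : R.
Hypothesis T0 : 0 <= T.
Local Notation D := (`[0%R, T]%classic `*` [set: Omega]).

Lemma meas_wrtE (G : set (set Omega)) (f : Omega -> R) :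
  sigma_algebra [set: Omega] G ->
  meas_wrt G f <-> measurable_fun setT (f : g_sigma_algebraType G -> R).
Proof.
move=> sG; have GE (E : set (g_sigma_algebraType G)) : measurable E = G E.
  by rewrite /measurable/= sigma_algebra_id.
split=> [mf _ C mC|mf C mC]; first by rewrite setTI GE; exact: mf.
by have := mf measurableT C mC; rewrite setTI GE.
Qed.

Lemma measurable_process_section (v : R -> Omega -> R) t : t \in `[0, T] ->
  measurable_fun D (fun q : R * Omega => v q.1 q.2) -> measurable_fun setT (v t).
Proof.
move=> tT mv; have : measurable_fun setT
    ((fun q : R * Omega => v q.1 q.2) \o (fun o => (t, o))).
  apply: (measurable_comp _ _ mv).
  - exact: measurableX.
  - by move=> _ [w _ <-]; split.
  - exact: pair1_measurable.
by [].
Qed.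

Lemma measurable_path (v : R -> Omega -> R) o :
  measurable_fun D (fun q : R * Omega => v q.1 q.2) ->
  measurable_fun `[0, T] (v^~ o).
Proof.
move=> mv; have : measurable_fun `[0, T]
    ((fun q : R * Omega => v q.1 q.2) \o (fun s => (s, o))).
  apply: (measurable_comp _ _ mv).
  - exact: measurableX.
  - by move=> _ [s st <-]; split.
  - by apply: measurable_funTS; exact: pair2_measurable.
by [].
Qed.

Let energy m (v : vprocess (R := R) (Omega := Omega) m) (o : Omega) : \bar R :=
  (\int[mu]_(t in `[0%R, T]) (dot (v t o) (v t o))%:E)%E.

Let dot_ge0 m (v : 'cV[R]_m) : 0 <= dot v v.
Proof. by rewrite dotE; apply: sumr_ge0 => i _; rewrite -expr2 sqr_ge0. Qed.

Let energy_ge0 m (v : vprocess (R := R) (Omega := Omega) m) o : (0 <= energy v o)%E.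
Proof. by apply: integral_ge0 => t _; rewrite lee_fin. Qed.

Let measurable_energy m (v : vprocess (R := R) (Omega := Omega) m) :
  jointly_measurable T v -> measurable_fun setT (energy v).
Proof.
move=> mv.
have md : measurable_fun D (fun q : R * Omega => dot (v q.1 q.2) (v q.1 q.2)).
  by apply: measurable_dot => j; exact: mv.
have mdr : measurable_fun setT (EFin \o ((fun q : R * Omega =>
  dot (v q.1 q.2) (v q.1 q.2)) \_ D)).
  by apply/measurable_EFinP/(measurable_restrictT _ _).1 => //; exact: measurableX.
have d0 q : (0 <= (EFin \o ((fun q : R * Omega =>
  dot (v q.1 q.2) (v q.1 q.2)) \_ D)) q)%E.
  by rewrite lee_fin patchE; case: ifP.
have := measurable_fun_fubini_tonelli_G (m1 := mu) _ mdr d0.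
apply: eq_measurable_fun => o _; rewrite /fubini_G /energy [RHS]integral_mkcond.
apply: eq_integral => t _; rewrite /= !patchE.
have -> : ((t, o) \in D) = (t \in `[0, T]%classic).
  by apply/idP/idP; rewrite !inE; [case|split].
by case: ifP.
Qed.

(** Finite expected energy makes the energy of almost every path finite, and the energy dominates
    the square of each entry. *)
Lemma control_square_integrable m (F : R -> set (set Omega))
    (v : vprocess (R := R) (Omega := Omega) m) :
  control P T F v -> {ae P, forall o, square_integrable_path T (v^~ o)}.
Proof.
move=> [mv _ vy].
have ie : P.-integrable setT (energy v).
  apply/integrableP; split; first exact: measurable_energy.
  by under eq_integral do rewrite gee0_abs ?energy_ge0//.
have := integrable_ae measurableT ie; apply: filterS => o /(_ I) eo i.
have mvi := measurable_path (v := fun t o => v t o i 0) o (mv i).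
split=> //; apply/integrableP; split.
  by apply/measurable_EFinP; exact: measurable_funX.
apply: (@le_lt_trans _ _ (energy v o)); last first.
  by rewrite ltey_eq eo.
apply: ge0_le_integral => //.
- by do 2 apply: measurableT_comp => //; exact: measurable_funX.
- apply/measurable_EFinP; apply: measurable_dot => j;
  exact: (measurable_path (v := fun t o => v t o j 0) o (mv j)).
- move=> s _; rewrite abse_EFin lee_fin ger0_norm ?sqr_ge0// dotE (bigD1 i)//= -expr2.
  by rewrite lerDl; apply: sumr_ge0 => j _; rewrite -expr2 sqr_ge0.
Qed.

Lemma perturbE m (u omega : vprocess (R := R) (Omega := Omega) m) e t o i :
  perturb u omega e t o i 0 = u t o i 0 + e * omega t o i 0.
Proof. by rewrite /perturb !mxE. Qed.

Lemma control_perturb m (F : R -> set (set Omega))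
    (u omega : vprocess (R := R) (Omega := Omega) m) e :
  (forall t, 0 <= t <= T -> sigma_algebra [set: Omega] (F t)) ->
  control P T F u -> control P T F omega -> control P T F (perturb u omega e).
Proof.
move=> sF [mu_ au uy] [mo ao oy].
have mvx : jointly_measurable T (perturb u omega e).
  move=> i; rewrite (_ : (fun q => _) = fun q => u q.1 q.2 i 0 + e *
    omega q.1 q.2 i 0); last first.
    by apply/funext => q; exact: perturbE.
  apply: measurable_funD; first exact: mu_.
  by apply: measurable_funM => //; exact: mo.
split.
- exact: mvx.
- move=> t tT i; apply/(meas_wrtE _ (sF t tT)).
  under eq_fun do rewrite perturbE.
  apply: measurable_funD; first by apply/(meas_wrtE _ (sF t tT)); exact: au.
  apply: measurable_funM => //; apply/(meas_wrtE _ (sF t tT)); exact: ao.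
(* The energy bound comes from [(a + e b)^2 <= 2 a^2 + 2 e^2 b^2], entry by entry. *)
have e20 : 0 <= 2 * e ^+ 2 by apply: mulr_ge0 => //; exact: sqr_ge0.
have meu := measurable_energy mu_; have meo := measurable_energy mo.
apply: (@le_lt_trans _ _ (\int[P]_o (2%:E * energy u o + (2 * e ^+ 2)%:E *
  energy omega o)))%E; last first.
  have mZ c (v : vprocess (R := R) (Omega := Omega) m) : measurable_fun setT (energy v) ->
      measurable_fun setT (fun o => c%:E * energy v o)%E by move=> mv;
        exact: measurable_funeM.
  rewrite ge0_integralD//; last 4 first.
  - by move=> o _; rewrite mule_ge0 ?energy_ge0.
  - exact: mZ.
  - by move=> o _; rewrite mule_ge0 ?energy_ge0// lee_fin.
  - exact: mZ.
  have sc c (v : vprocess (R := R) (Omega := Omega) m) : 0 <= c ->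
      measurable_fun setT (energy v) ->
      (\int[P]_o (c%:E * energy v o) = c%:E * \int[P]_o energy v o)%E.
    by move=> c0 mv; apply: ge0_integralZl => //; rewrite lee_fin.
  rewrite (sc 2 _ (ler0n _ _) meu) (sc _ _ e20 meo).
  by apply: lte_add_pinfty; apply: lte_mul_pinfty;
    [rewrite lee_fin| |exact: uy|rewrite lee_fin| |exact: oy].
apply: ge0_le_integral => //.
- by move=> o _; exact: energy_ge0.
- exact: measurable_energy mvx.
- by apply: emeasurable_funD; apply: measurable_funeM.
move=> o _; rewrite /energy.
have mdd (v : vprocess (R := R) (Omega := Omega) m) : jointly_measurable T v ->
    measurable_fun `[0, T] (fun t => (dot (v t o) (v t o))%:E).
  by move=> mv; apply/measurable_EFinP; apply: measurable_dot => j;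
    exact: (measurable_path (v := fun t o => v t o j 0) o (mv j)).
have sc c (v : vprocess (R := R) (Omega := Omega) m) : 0 <= c -> jointly_measurable T v ->
    (c%:E * \int[mu]_(t in `[0%R, T]) (dot (v t o) (v t o))%:E =
     \int[mu]_(t in `[0%R, T]) (c%:E * (dot (v t o) (v t o))%:E))%E.
  move=> c0 mv; apply/esym/ge0_integralZl => //; first exact: mdd.
  by move=> t _; rewrite lee_fin.
rewrite !sc//.
rewrite -ge0_integralD//; last 4 first.
- by move=> t _; rewrite -EFinM lee_fin mulr_ge0.
- by apply: measurable_funeM; exact: mdd.
- by move=> t _; rewrite -EFinM lee_fin mulr_ge0.
- by apply: measurable_funeM; exact: mdd.
apply: ge0_le_integral => //.
- by move=> t _; rewrite lee_fin.
- exact: mdd mvx.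
- by apply: emeasurable_funD; apply: measurable_funeM; exact: mdd.
move=> t _; rewrite -!EFinM -EFinD lee_fin !dotE !mulr_sumr -big_split/=.
apply: ler_sum => i _; rewrite !perturbE.
have := sqr_ge0 (u t o i 0 - e * omega t o i 0); nra.
Qed.

End controls.

Section information.
Context {d} {Omega : measurableType d} {R : realType}.
Context {n : nat} (x : vprocess (R := R) (Omega := Omega) n).

Lemma sigma_algebra_generated t : sigma_algebra [set: Omega] (generated x t).
Proof. exact: smallest_sigma_algebra. Qed.

Lemma generated_le s t : s <= t -> generated x s `<=` generated x t.
Proof.
move=> st; apply: sub_sigma_algebra2 => E [r [i [C [/andP[r0 rs] mC ->]]]].
by exists r, i, C; rewrite r0 (le_trans rs).
Qed.

Lemma generated_state s t i : 0 <= s <= t -> meas_wrt (generated x t) (fun o =>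
  x s o i 0).
Proof.
by move=> st C mC; apply: sub_sigma_algebra; exists s, i, C.
Qed.

Lemma generated_sub T (FF : R -> set (set Omega)) t : filtration T FF ->
  adapted T FF x -> 0 <= t <= T -> generated x t `<=` FF t.
Proof.
move=> [sF _ FF_le] ax /andP[t0 tT]; apply: smallest_sub; first by apply: sF; rewrite t0.
move=> E [s [i [C [/andP[s0 st] mC ->]]]].
apply: (FF_le s t) => //; apply: ax => //; first by rewrite s0 (le_trans st).
Qed.

End information.

Section weight_measurability.
Context {d} {Omega : measurableType d} {R : realType}.
Context {n m r : nat} (p : lqg R n m r).
Local Notation mu := (@lebesgue_measure R).
Local Notation T := (hor p).
Variables (x : vprocess (R := R) (Omega := Omega) n) (v : vprocess (R := R) (Omega :=
  Omega) m).
Hypothesis mx : jointly_measurable T x.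
Hypothesis mv : jointly_measurable T v.

Let T0 : 0 <= T. Proof. by rewrite ltW// hor_gt0. Qed.

Lemma measurable_weight : measurable_fun setT (weight p x v).
Proof.
have xT i : measurable_fun setT (fun o => x T o i 0).
  apply: (@measurable_process_section _ _ _ T (fun t o => x t o i 0)) => //.
  by rewrite in_itv/= T0 lexx.
apply: measurableT_comp => //; apply: measurable_funM => //; apply: measurable_funD.
  apply: measurable_funM => //; apply: measurable_time_integral => //.
  apply: measurable_funB; [apply: measurable_funB; [apply: measurable_funD;
    [apply: measurable_funD|]|]|].
  - by apply: measurable_dot => j; [apply: measurable_cmulmx => i|]; exact: mx.
  - apply: measurable_funM => //.
    by apply: measurable_dot => j; [apply: measurable_cmulmx => i; exact: mv|exact: mx].
  - by apply: measurable_dot => j; [apply: measurable_cmulmx => i|]; exact: mv.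
  - by apply: measurable_funM => //; apply: measurable_dot => j //; exact: mx.
  - by apply: measurable_funM => //; apply: measurable_dot => j //; exact: mv.
apply: measurable_funM => //.
by apply: measurable_dot => j; [apply: measurable_cmulmx => i|]; exact: xT.
Qed.

End weight_measurability.

Section gradient_expectation.
Context {d} {Omega : measurableType d} {R : realType}.
Variable P : probability Omega R.
Context {n m r : nat} (p : lqg R n m r).
Local Notation mu := (@lebesgue_measure R).
Local Notation T := (hor p).
Local Notation A := (A_ p).
Local Notation B := (B_ p).
Local Notation D := (`[0%R, T]%classic `*` [set: Omega]).
Variables (x : vprocess (R := R) (Omega := Omega) n).
Variables (u omega : vprocess (R := R) (Omega := Omega) m).
Hypothesis mx : jointly_measurable T x.
Hypothesis mu_ : jointly_measurable T u.
Hypothesis mo : jointly_measurable T omega.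

Let T0 : 0 <= T. Proof. by rewrite ltW// hor_gt0. Qed.

Let g s o := Q_ p *m x s o + S_ p *m u s o - eta_ p.
Let kern t i s o := (expm ((s - t) *: A^T) *m g s o) i 0.

Let mg j : measurable_fun D (fun q : R * Omega => g q.1 q.2 j 0).
Proof.
apply: measurable_addmx => // i; apply: measurable_addmx => a.
- by apply: measurable_cmulmx => b; exact: mx.
- by apply: measurable_cmulmx => b; exact: mu_.
Qed.

Let measurable_expm {d'} {U : measurableType d'} (E : set U) (f : U -> R) k
    (M : 'M[R]_k) i j : measurable_fun E f ->
  measurable_fun E (fun q => expm (f q *: M) i j).
Proof.
move=> mf; apply: (measurableT_comp (f := fun s : R => expm (s *: M) i j)) => //.
by apply: continuous_measurable_fun; exact: continuous_expm.
Qed.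

Let mkern t i : measurable_fun D (fun q : R * Omega => kern t i q.1 q.2).
Proof.
apply: measurable_mulmx => [a b|j]; last exact: mg.
by apply: measurable_expm; apply: measurable_funB => //; exact: measurable_funTS.
Qed.

Let measurable_memory i :
  measurable_fun D (fun q : R * Omega => \int[mu]_(s in `[0, q.1]) kern q.1 i s q.2).
Proof.
(* The clause [z.1.1 <= T] keeps the integration time [z.2] within [[0, T]], where [g] is known to
   be measurable. *)
pose E := [set z : (R * Omega) * R | (0 <= z.2) && (z.2 <= z.1.1) && (z.1.1 <= T)].
have mE : measurable E.
  have : measurable_fun [set: (R * Omega) * R] (fun z : (R * Omega) * R =>
      (0 <= z.2) && (z.2 <= z.1.1) && (z.1.1 <= T)).
    apply: measurable_and; [apply: measurable_and|]; apply: measurable_fun_ler => //.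
    - exact: measurableT_comp.
    - exact: measurableT_comp.
  by move=> /(_ measurableT [set true]); rewrite setTI; apply.
apply: (measurable_Rintegral_xsection mu (E := E)
  (f := fun z : (R * Omega) * R => kern z.1.1 i z.2 z.1.2)) => //.
- exact: measurableX.
- apply: measurable_mulmx => [a b|j].
    apply: measurable_expm; apply: measurable_funB; first exact: measurable_funTS.
    by apply: measurable_funTS; exact: measurableT_comp.
  have : measurable_fun E ((fun q : R * Omega => g q.1 q.2 j 0) \o
      (fun z : (R * Omega) * R => (z.2, z.1.2))).
    apply: (measurable_comp _ _ (mg j)).
    + exact: measurableX.
    + move=> _ [z /andP[/andP[z0 z1] z2] <-]; split=> //=.
      by rewrite in_itv/= z0 (le_trans z1).
    + apply: measurable_funTS; apply: measurable_fun_pair => //.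
      exact: measurableT_comp.
  by [].
- move=> [t o] s [/= + _]; rewrite in_itv/= => /andP[t0 tT]; rewrite in_itv/=.
  split=> [/andP[s0 st]|/andP[/andP[s0 st] _]]; last by rewrite s0.
  by rewrite /E /= s0 st tT.
Qed.

(* [dot omega (gradient m1 m2)] is linear in [(m1, m2)]; the index [ord0] stands
   for [m1] and the index [lift ord0 i] for the i-th entry of [m2]. *)
Definition gradient_coef (j : 'I_n.+1) (t : R) (o : Omega) : R :=
  if unlift ord0 j is Some i then ((expm (- t *: A^T))^T *m (B *m omega t o)) i 0
  else dot (omega t o) (R_ p *m u t o + (S_ p)^T *m x t o - zeta_ p -
    B^T *m vint `[0, t] (fun s => expm ((s - t) *: A^T) *m g s o)).

Definition consM (m1 : R) (m2 : 'cV[R]_n) (j : 'I_n.+1) : R :=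
  if unlift ord0 j is Some i then m2 i 0 else m1.

Lemma dot_gradientE m1 m2 t o :
  dot (omega t o) (gradient p x u m1 m2 t o) =
  \sum_j gradient_coef j t o * consM m1 m2 j.
Proof.
rewrite big_ord_recl {1 2}/gradient_coef /consM unlift_none.
rewrite /gradient dotDr dotZr addrC [m1 * _]mulrC; congr (_ + _).
rewrite dot_mulmxr trmxK dot_mulmxr dotE; apply: eq_bigr => i _.
by rewrite /gradient_coef liftK.
Qed.

Lemma measurable_gradient_coef j :
  measurable_fun D (fun q : R * Omega => gradient_coef j q.1 q.2).
Proof.
rewrite /gradient_coef; case: unliftP => [i _|_].
  apply: measurable_mulmx => [a b|a].
    rewrite (_ : (fun q => _) = fun q => expm (- q.1 *: A^T) b a); last first.
      by apply/funext => q; rewrite mxE.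
    by apply: measurable_expm; apply: measurableT_comp => //; exact: measurable_funTS.
  by apply: measurable_cmulmx => b; exact: mo.
apply: measurable_dot => a; first exact: mo.
apply: measurable_addmx => [b|b].
  apply: measurable_addmx => // c; apply: measurable_addmx => e.
  - by apply: measurable_cmulmx => f; exact: mu_.
  - by apply: measurable_cmulmx => f; exact: mx.
apply: measurable_oppmx => e; apply: measurable_cmulmx => c.
rewrite (_ : (fun q => _) = fun q => \int[mu]_(s in `[0, q.1]) kern q.1 c s q.2);
  last first.
  by apply/funext => q; rewrite mxE.
exact: measurable_memory.
Qed.

Lemma measurable_dot_gradient (M1 : R -> Omega -> R) (M2 : vprocess n) :
  measurable_fun D (fun q : R * Omega => M1 q.1 q.2) -> jointly_measurable T M2 ->
  measurable_fun D (fun q : R * Omega => dot (omega q.1 q.2)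
    (gradient p x u (M1 q.1 q.2) (M2 q.1 q.2) q.1 q.2)).
Proof.
move=> mM1 mM2.
rewrite (_ : (fun q => _) = fun q => \sum_j gradient_coef j q.1 q.2 *
    consM (M1 q.1 q.2) (M2 q.1 q.2) j); last first.
  by apply/funext => q; exact: dot_gradientE.
apply: measurable_sum => j; apply: measurable_funM.
  exact: measurable_gradient_coef.
by rewrite /consM; case: unliftP => // i _; exact: mM2.
Qed.

Hypothesis au : forall t, 0 <= t <= T -> forall i,
  meas_wrt (generated x t) (fun o => u t o i 0).
Hypothesis ao : forall t, 0 <= t <= T -> forall i,
  meas_wrt (generated x t) (fun o => omega t o i 0).
Hypothesis mG : forall t, 0 <= t <= T -> generated x t `<=` measurable.
Hypothesis sxu : {ae P, forall o, square_integrable_path T (x^~ o) /\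
  square_integrable_path T (u^~ o)}.

Lemma completed_gradient_coef j t : t \in `[0, T] ->
  measurable_fun setT (gradient_coef j t : completedType P (generated x t) -> R).
Proof.
move=> tT; have tT' : 0 <= t <= T by move: tT; rewrite in_itv.
have /andP[t0 tT''] := tT'.
have sG := @sigma_algebra_generated _ _ _ _ x t.
have C f : meas_wrt (generated x t) f ->
    measurable_fun setT (f : completedType P (generated x t) -> R).
  exact: (meas_wrt_completed (P := P) sG (mG tT')).
have Cu i := C _ (au tT' i); have Co i := C _ (ao tT' i).
have tt : 0 <= t <= t by rewrite t0 lexx.
have Cx i := C _ (@generated_state _ _ _ _ x t t i tt).
rewrite /gradient_coef; case: unliftP => [i _|_].
  apply: measurable_mulmx => [a b|a]; first exact: measurable_cst.
  by apply: measurable_cmulmx => b; exact: Co.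
apply: measurable_dot => a; first exact: Co.
apply: measurable_addmx => [b|b].
  apply: measurable_addmx => // c; apply: measurable_addmx => e.
  - by apply: measurable_cmulmx => f; exact: Cu.
  - by apply: measurable_cmulmx => f; exact: Cx.
apply: measurable_oppmx => e; apply: measurable_cmulmx => c.
rewrite (_ : (fun o => _) = fun o => \int[mu]_(s in `[0, t]) kern t c s o); last first.
  by apply/funext => o; rewrite mxE.
(* At each [s <= t] the integrand is measurable for [generated x t] itself; only the integration
   over [s] leads to the completion. *)
apply: (@completed_time_integral _ _ _ P _ sG (mG tT') t t0 (kern t c)).
- apply: measurable_funS (mkern t c); first exact: measurableX.
  move=> [s o] [/= + _]; rewrite in_itv/= => /andP[s0 st].
  have sT : s \in `[0, T] by rewrite in_itv/= s0 (le_trans st).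
  by split.
- apply: filterS sxu => o [sx su].
  have sg : square_integrable_path T (g^~ o).
    apply: square_integrable_pathD; last exact: square_integrable_path_cst.
    by apply: square_integrable_pathD; exact: square_integrable_path_mulmx.
  apply: (integrable_sub_itv _ tT).
  apply: integrable_cmulmx => [a' b'|j']; last exact: square_integrable_int.
  apply: continuous_subspaceT => s.
  apply: (@continuous_comp _ _ _ (fun s => s - t) (fun z : R => expm (z *: A^T) a' b')).
    by apply: cvgB; [exact: cvg_id|exact: cvg_cst].
  exact: continuous_expm.
- move=> s; rewrite in_itv/= => /andP[s0 st].
  have sT : 0 <= s <= T by rewrite s0 (le_trans st).
  apply/(meas_wrtE _ sG); apply: measurable_cmulmx => b'.
  apply: measurable_addmx => // i1; apply: measurable_addmx => i2.
  - apply: measurable_cmulmx => h; apply/(meas_wrtE _ sG).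
    by apply: generated_state; rewrite s0 st.
  - apply: measurable_cmulmx => h; apply/(meas_wrtE _ sG) => C' mC'.
    by apply: (generated_le st); exact: au.
Qed.

End gradient_expectation.

(** * Directional derivative of the exponential cost *)

Theorem proposition2 (R : realType) (n m r : nat) (p : lqg R n m r)
  (d : measure_display) (Omega : measurableType d) (P : probability Omega R)
  (* the filtered probability space, its Wiener process, the initial state *)
  (FF : R -> set (set Omega)) (hFF : filtration (hor p) FF)
  (w : vprocess (R := R) (Omega := Omega) r) (hw : wiener P (hor p) FF w)
  (x0 : Omega -> 'cV[R]_n)
  (hx0 : forall i, meas_wrt (FF 0) (fun o => x0 o i 0))
  (* the controlled dynamics *)
  (N : vprocess n) (hN : wiener_integral P (hor p) (sig_ p) w N)
  (X : vprocess (R := R) (Omega := Omega) m -> vprocess n)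
  (hX : forall v, control P (hor p) FF v -> state p x0 N v (X v))
  (* u and omega, adapted to the information F_t = sigma(x_s; 0 <= s <= t) *)
  (u omega : vprocess m)
  (hinfo : adapted (hor p) FF (X u))
  (hu : control P (hor p) (generated (X u)) u)
  (homega : control P (hor p) (generated (X u)) omega)
  (* M1 and M2, as jointly measurable versions *)
  (M1 : R -> Omega -> R) (M2 : vprocess n)
  (hM1 : forall t : R, 0 <= t <= hor p ->
     cond_exp P (generated (X u) t) (weight p (X u) u) (M1 t))
  (hM2 : forall t : R, 0 <= t <= hor p -> forall i,
     cond_exp P (generated (X u) t)
       (fun o => weight p (X u) u o * adjoint p (X u) u o i 0)
       (fun o => M2 t o i 0))
  (hM1m : measurable_fun (`[0, hor p] `*` [set: Omega])
     (fun q : R * Omega => M1 q.1 q.2))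
  (hM2m : jointly_measurable (hor p) M2)
  (* limit and expectation may be interchanged *)
  (hlim : 'E_P[diff_quot p X u omega e]%E @[e --> 0^'] -->
     'E_P[fun o => (lim (diff_quot p X u omega e o @[e --> 0^']))%R]%E)
  (* expectation and time integral may be interchanged *)
  (hfub : (@lebesgue_measure R \x P)%E.-integrable (`[0, hor p] `*` [set: Omega])
     (fun q : R * Omega =>
        (dot (omega q.1 q.2)
           (gradient p (X u) u (weight p (X u) u q.2)
              (weight p (X u) u q.2 *: adjoint p (X u) u q.2) q.1 q.2))%:E)) :
  ((cost P p X (perturb u omega e) - cost P p X u) * (e^-1)%:E)%E
    @[e --> 0^'] -->
  ((risk p)%:E *
   'E_P[fun o => (\int[@lebesgue_measure R]_(t in `[0, hor p])
          dot (omega t o) (gradient p (X u) u (M1 t o) (M2 t o) t o))%R])%E.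
Proof.
set T := hor p.
have T0 : 0 <= T by rewrite ltW// hor_gt0.
pose G t := generated (X u) t.
have sG t : sigma_algebra [set: Omega] (G t) by exact: sigma_algebra_generated.
have [sF mF _] := hFF.
have GF t : 0 <= t <= T -> G t `<=` FF t by exact: generated_sub.
have mG t : 0 <= t <= T -> G t `<=` measurable.
  by move=> tT; apply: subset_trans (GF t tT) (mF t tT).
(* The perturbed control is adapted to the information of [X u], which need not be that of its own
   state; [hX] applies to it through the larger filtration [FF]. *)
have toFF (v : vprocess m) : control P T G v -> control P T FF v.
  by move=> [jv av ev]; split=> // t tT i C mC; apply: (GF t tT); exact: av.
have cu := toFF _ hu; have co := toFF _ homega.
have ce e := control_perturb e sF cu co.
have stu := hX _ cu; have ste e := hX _ (ce e).
have [jx _] := stu; have [ju au _] := hu; have [jo ao _] := homega.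
pose W := weight p (X u) u.
(* The finiteness of the cost at [u] is contained in [hM1] at time 0; the perturbed costs may still
   be infinite. *)
have iW : P.-integrable setT (EFin \o W).
  by have [] := hM1 0; rewrite ?lexx.
have mW : measurable_fun setT W by exact: measurable_weight.
have costE e : ((cost P p X (perturb u omega e) - cost P p X u) * (e^-1)%:E =
    'E_P[diff_quot p X u omega e])%E.
  have mWe : measurable_fun setT (weight p (X (perturb u omega e)) (perturb u omega e)).
    by apply: measurable_weight; [have [] := ste e|have [] := ce e].
  rewrite /cost unlock -(ge0_integralBZ_EFin (e^-1) mWe mW) //; last 2 first.
  - by move=> o; exact: expR_ge0.
  - by move=> o; exact: expR_ge0.
  apply: eq_integral => o _; rewrite /diff_quot; congr EFin.
  rewrite mulrCA; congr (_ * _); rewrite mulrBr mulr1; congr (_ - _).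
  by rewrite /weight -expRD; congr expR; ring.
under eq_cvg do rewrite costE.
suff <- : ('E_P[fun o => (lim (diff_quot p X u omega e o @[e --> 0^']))%R] =
  (risk p)%:E * 'E_P[fun o => (\int[@lebesgue_measure R]_(t in `[0, hor p])
          dot (omega t o) (gradient p (X u) u (M1 t o) (M2 t o) t o))%R])%E by [].
rewrite unlock.
have su := control_square_integrable cu; have so := control_square_integrable co.
pose f (q : R * Omega) := dot (omega q.1 q.2)
  (gradient p (X u) u (W q.2) (W q.2 *: adjoint p (X u) u q.2) q.1 q.2).
pose g (q : R * Omega) := dot (omega q.1 q.2)
  (gradient p (X u) u (M1 q.1 q.2) (M2 q.1 q.2) q.1 q.2).
have hf : (@lebesgue_measure R \x P)%E.-integrable
    (`[0%R, T]%classic `*` [set: Omega]) (EFin \o f) := hfub.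
transitivity (\int[P]_o ((risk p)%:E * (\int[@lebesgue_measure R]_(t in `[0%R,
  T]) f (t, o))%R%:E))%E.
  apply: ae_eq_integral_nonmeasurable; have aif := ae_integrable_time hf.
  apply: filterS3 su so aif => o suo soo ifo.
  have := diff_quot_cvg suo soo stu ste => /cvg_lim -> //.
  rewrite -EFinM; congr EFin; rewrite mulrCA; congr (_ * _).
  (* Dividing by the positive weight carries integrability along the path from [f] to the gradient
     with [m1 = 1]. *)
  have W0 : W o != 0 by rewrite gt_eqF// expR_gt0.
  have fW t : f (t, o) = W o * dot (omega t o)
      (gradient p (X u) u 1 (adjoint p (X u) u o) t o).
    by rewrite /f -{1}(mulr1 (W o)) gradientZ dotZr.
  have ih : (@lebesgue_measure R).-integrable `[0, T] (EFin \o (fun t =>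
      dot (omega t o) (gradient p (X u) u 1 (adjoint p (X u) u o) t o))).
    have := @integrableZl _ _ _ (@lebesgue_measure R) _ (measurable_itv _) (W o)^-1 _ ifo.
    apply: eq_integrable; first exact: measurable_itv.
    by move=> t _; rewrite -/(f (t, o)) fW -EFinM mulKf.
  rewrite -(@RintegralZl _ _ _ (@lebesgue_measure R) _ _ (W o) (measurable_itv _) ih).
  by apply: eq_Rintegral => t _; rewrite fW.
rewrite (integralZl measurableT (integrable_time_integral hf)).
apply: (congr1 (fun z => (risk p)%:E * z)%E); apply/esym.
have mg : measurable_fun (`[0%R, T]%classic `*` [set: Omega]) g.
  exact: measurable_dot_gradient.
(* At a fixed time, [f] and [g] are combinations with the same coefficients: of the weight and the
   weighted adjoint for [f], of their conditional expectations for [g]. *)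
apply: (eq_integral_time_integral hf mg) => t tT ift.
have tT' : 0 <= t <= T by move: tT; rewrite in_itv.
pose zeta j o := consM (W o) (W o *: adjoint p (X u) u o) j.
pose M j o := consM (M1 t o) (M2 t o) j.
have condM j : cond_exp P (G t) (zeta j) (M j).
  rewrite /zeta /M /consM; case: unliftP => [i _|_]; last exact: hM1.
  by under eq_fun do rewrite mxE; exact: hM2.
have sxu : {ae P, forall o, square_integrable_path T ((X u)^~ o) /\
    square_integrable_path T (u^~ o)}.
  apply: filterS su => o suo; split=> // i; apply: continuous_square_integrable.
  have [_ /(_ o) [|+ _]] := stu; last exact.
  by move=> j; exact: square_integrable_int (suo j).
have ma j := completed_gradient_coef jx ju au ao mG sxu j tT.
have fE o : f (t, o) = \sum_j gradient_coef p (X u) u omega j t o * zeta j o.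
  exact: dot_gradientE.
have gE o : g (t, o) = \sum_j gradient_coef p (X u) u omega j t o * M j o.
  exact: dot_gradientE.
have iZ : P.-integrable setT (EFin \o (fun o =>
    \sum_j gradient_coef p (X u) u omega j t o * zeta j o)).
  by apply: eq_integrable ift => // o _ /=; rewrite -fE.
split.
  under eq_integral do rewrite -/(g (t, _)) gE.
  under [RHS]eq_integral do rewrite -/(f (t, _)) fE.
  exact: (integral_cond_exp_sum (sG t) (mG t tT') condM ma iZ).
under eq_integral do rewrite -/(g (t, _)) gE.
under [leRHS]eq_integral do rewrite -/(f (t, _)) fE.
exact: (le_integral_cond_exp_sum (sG t) (mG t tT') condM ma iZ).
Qed.
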